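(* Consider the ARRU described in the context. Assume there exist constants $\rho_1,\rho_2\in[0,1]$ with $\rho_1\ge\rho_2$ such that $\hat\rho_{1,n}\to\rho_1$ and $\hat\rho_{2,n}\to\rho_2$ almost surely. Then $Z_n\to\rho_1$ a.s. if $m_1>m_2$; $Z_n\to Z_\infty$ a.s. if $m_1=m_2$, where $Z_\infty$ is a random variable with $P(Z_\infty\in[\rho_2,\rho_1])=1$; and $Z_n\to\rho_2$ a.s. if $m_1<m_2$.
   Context: ARRU model. Let $0<a\le b<\infty$, let $S$ be a measurable space and $u:S\to[a,b]$ measurable. Let $\{\xi_{1,n}\}_{n\ge1}$ and $\{\xi_{2,n}\}_{n\ge1}$ be independent sequences of i.i.d. $S$-valued random variables with laws $\mu_1,\mu_2$; set $D_{j,n}=u(\xi_{j,n})$ and $m_j=E[D_{j,n}]$, $j=1,2$. Let $\{U_n\}$ be i.i.d. uniform on $(0,1)$, independent of the $\xi$'s and of auxiliary random variables $\varphi_n$. The urn starts with $y_{1,0}>0$ red and $y_{2,0}>0$ white balls; $Y_n=Y_{1,n}+Y_{2,n}$, $Z_n=Y_{1,n}/Y_n$. Let $\mathcal F_n=\sigma\big(X_i,X_i\xi_{1,i}+(1-X_i)\xi_{2,i},\varphi_i: i\le n\big)$, with $U_{n+1}$ independent of $\mathcal F_n$ and the $\xi$'s. Thresholds $\hat\rho_{1,n}\ge\hat\rho_{2,n}$ are $[0,1]$-valued and $\mathcal F_n$-measurable. For $n\ge0$: $X_{n+1}=\mathbf 1\{U_{n+1}\le Z_n\}$, $W_{1,n}=\mathbf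 1\{Z_n\le\hat\rho_{1,n}\}$, $W_{2,n}=\mathbf 1\{Z_n\ge\hat\rho_{2,n}\}$, $Y_{1,n+1}=Y_{1,n}+X_{n+1}D_{1,n+1}W_{1,n}$, $Y_{2,n+1}=Y_{2,n}+(1-X_{n+1})D_{2,n+1}W_{2,n}$. *)

(* Defs.v *)
From HB Require Import structures.
From mathcomp Require Import all_boot all_order all_algebra.
From mathcomp Require Import all_classical all_reals all_analysis.
Set Implicit Arguments. Unset Strict Implicit. Unset Printing Implicit Defensive.
Import Order.TTheory GRing.Theory Num.Theory.
Import numFieldTopology.Exports numFieldNormedType.Exports.
Local Open Scope classical_set_scope.
Local Open Scope ring_scope.

Definition pre_class {dT : measure_display} {T : measurableType dT} {Om : Type}
  (f : Om -> T) : set (set Om) :=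
  [set f @^-1` B | B in [set B : set T | measurable B]].

Definition gen_sigma {Om : Type} (G : set (set Om)) : set (set Om) := <<s G >>.

Definition gen_family {Om I : Type} (C : I -> set (set Om)) : set (set Om) :=
  gen_sigma (\bigcup_(i in [set: I]) C i).

Definition mutually_indep {dO : measure_display} {Om : measurableType dO}
  {R : realType} (P : probability Om R) {I : eqType} (C : I -> set (set Om)) :=
  forall (J : seq I) (A : I -> set Om), uniq J ->
    (forall i, i \in J -> C i (A i)) ->
    P (\bigcap_(i in [set` J]) A i) = (\prod_(i <- J) P (A i))%E.

Definition indep2 {dO : measure_display} {Om : measurableType dO}
  {R : realType} (P : probability Om R) (C1 C2 : set (set Om)) :=
  forall A B, C1 A -> C2 B -> P (A `&` B) = (P A * P B)%E.

Definition as_cvg {dO : measure_display} {Om : measurableType dO}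
  {R : realType} (P : probability Om R) (V : nat -> Om -> R) (L : Om -> R) :=
  {ae P, forall w, (fun n => V n w) @ \oo --> L w}.

(* Main.v *)
(** The thresholds may anticipate the rewards, because nothing is assumed about
    the dependence between the phi's and the future xi's.  The argument therefore
    conditions on all the rewards at once: with G_n generated by F_n and all the
    xi's, only the uniform U_{n+1} is fresh, and the rewards enter through a law of
    large numbers with a rate.

    Since X_{n+1} - Z_n is orthogonal to G_n, the martingale with increments
    (X_{n+1} - Z_n) D_{1,n+1} W_{1,n} / Y_{1,n} is bounded in L^2 (the sum of its
    squared increments telescopes in 1 / Y_{1,n}), so that
    ln Y_{1,n} - sum_{k<n} D_{1,k+1} W_{1,k} / Y_k converges almost surely, and
    likewise for white.  As one of the W's is always 1, adding both colours gives
    2 ln Y_n >= a sum_{k<n} 1/Y_k - C, whence n <= C Y_n ln Y_n.  Pairwise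
    independence gives |sum_{k<n} (D_{j,k+1} - m_j)| <= C n^(3/4) almost surely, and
    Abel summation then makes sum_k (D_{j,k+1} - m_j) / Y_k converge.

    The rest is pathwise.  Put Q_n = ln Y_{1,n} - ln Y_{2,n}, the logit of Z_n.
    While Z stays below a level r < rho_1 one has W_1 = 1, hence Q increases by at
    least (m_1 - m_2) sum 1/Y_k - o(1); below a level r < rho_2 moreover W_2 = 0 and
    Z increases.  The steps of Q vanish and sum 1/Y_k diverges, so liminf Z >= rho_2
    always, Z converges when m_1 >= m_2, and its limit is rho_1 when m_1 > m_2.
    Exchanging the colours gives the remaining assertions. *)
Require Import Defs.
From HB Require Import structures.
From mathcomp Require Import all_boot all_order all_algebra.
From mathcomp Require Import all_classical all_reals all_analysis.
From mathcomp Require Import measurable_realfun ring lra zify.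
Import Order.TTheory GRing.Theory Num.Theory.
Import numFieldTopology.Exports numFieldNormedType.Exports.
Local Open Scope classical_set_scope.
Local Open Scope ring_scope.

Set Implicit Arguments.
Unset Strict Implicit.
Unset Printing Implicit Defensive.

(** * Real sequences and trajectories of the urn *)

Section real_sequences.
Context {R : realType}.
Implicit Types (x v g y q : nat -> R).

Lemma cvgn_osc x : cvgn x ->
  forall e, 0 < e -> exists N, forall s t, (N <= s)%N -> (N <= t)%N ->
    `|x t - x s| <= e.
Proof.
move=> /cvg_ex[l xl] e e0.
have e20 : 0 < e / 2 by lra.
have [N _ HN] := (cvgrPdist_le _ _).1 xl _ e20.
exists N => s t Ns Nt.
have := HN s Ns; have := HN t Nt => /= Ht Hs.
rewrite (_ : x t - x s = (l - x s) - (l - x t)); last by ring.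
rewrite (le_trans (ler_normB _ _))//; lra.
Qed.

Lemma telescope_sum_le v n : (forall n, 0 <= v n) ->
  \sum_(0 <= k < n) (v k - v k.+1) <= v 0%N.
Proof.
move=> v0; have -> : \sum_(0 <= k < n) (v k - v k.+1) = v 0%N - v n.
  elim: n => [|n IH]; first by rewrite big_geq// subrr.
  by rewrite big_nat_recr//= IH; ring.
by have := v0 n; lra.
Qed.

(** Adding [v k - v k.+1] to [x k] gives a term between 0 and [2 * (v k - v k.+1)], so the series is
    a difference of two nondecreasing sequences, bounded by [2 * v 0] and [v 0]. *)
Lemma is_cvg_series_telescope x v : (forall n, 0 <= v n) ->
  (forall n, `|x n| <= v n - v n.+1) ->
  cvgn (fun n => \sum_(0 <= k < n) x k).
Proof.
move=> v0 xv.
have cvp (u : nat -> R) C : (forall n, 0 <= u n) ->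
    (forall n, u n <= C * (v n - v n.+1)) -> 0 <= C ->
    cvgn (fun n => \sum_(0 <= k < n) u k).
  move=> u0 uv C0; apply: nondecreasing_is_cvgn.
    by apply/nondecreasing_seqP => n; rewrite big_nat_recr//= lerDl.
  exists (C * v 0%N) => _ [n _ <-].
  apply: (@le_trans _ _ (\sum_(0 <= k < n) C * (v k - v k.+1))).
    exact: ler_sum.
  by rewrite -mulr_sumr ler_wpM2l// telescope_sum_le.
have vd n : 0 <= v n - v n.+1 by exact: le_trans (xv n).
have -> : (fun n => \sum_(0 <= k < n) x k) =
  (fun n => \sum_(0 <= k < n) (x k + (v k - v k.+1))) \-
  (fun n => \sum_(0 <= k < n) (v k - v k.+1)).
  apply/funext => n /=; rewrite -sumrB; apply: eq_bigr => k _; ring.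
apply: is_cvgB.
- apply: (cvp _ 2) => // n; move: (xv n); rewrite ler_norml => /andP[]; lra.
- by apply: (cvp _ 1) => // n; rewrite mul1r.
Qed.

Lemma abel_summation (d g : nat -> R) n :
  \sum_(0 <= k < n) d k * g k =
  (\sum_(0 <= k < n) d k) * g n +
  \sum_(0 <= k < n) (\sum_(0 <= j < k.+1) d j) * (g k - g k.+1).
Proof.
elim: n => [|n IH]; first by rewrite !big_geq// mul0r add0r.
by rewrite !(@big_nat_recr _ _ _ n)//= IH; ring.
Qed.

(* A run below [l] starts at a level close to [l], because the steps are small. *)
Lemma liminf_ge_of_runs q (l : R) :
  (forall e, 0 < e -> exists N, forall n, (N <= n)%N -> `|q n.+1 - q n| <= e) ->
  (forall e, 0 < e -> exists N, forall s t, (N <= s)%N -> (s <= t)%N ->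
     (forall k, (s <= k < t)%N -> q k <= l) -> q s - e <= q t) ->
  (forall N, exists2 n, (N <= n)%N & l < q n) ->
  forall e, 0 < e -> exists N, forall n, (N <= n)%N -> l - e <= q n.
Proof.
move=> step runs io e e0.
have e20 : 0 < e / 2 by lra.
have [N1 H1] := step _ e20; have [N2 H2] := runs _ e20.
have [n0 n0N qn0] := io (maxn N1 N2).
move: n0N; rewrite geq_max => /andP[N1n0 N2n0].
exists n0 => n n0n.
have [s [/andP[n0s sn] qs run]] : exists s, [/\ (n0 <= s <= n)%N,
    l - e / 2 <= q s & forall k, (s <= k < n)%N -> q k <= l].
  elim: n n0n => [|n IH] n0n.
    exists n0; rewrite leqnn n0n; split => //; first by lra.
    by move=> k /andP[_]; rewrite ltn0.
  move: n0n; rewrite leq_eqVlt => /predU1P[n0E|].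
    exists n.+1; rewrite n0E; split => //; [by rewrite leqnn| |].
      by rewrite -n0E; lra.
    by move=> k /andP[nk kn]; move: (leq_trans kn nk); rewrite ltnn.
  rewrite ltnS => n0n; have [s [/andP[n0s sn] qs run]] := IH n0n.
  have [qnl|qnl] := leP (q n) l.
    exists s; split => //; first by rewrite n0s leqW.
    move=> k /andP[sk]; rewrite ltnS leq_eqVlt => /predU1P[->//|kn].
    by apply: run; rewrite sk.
  exists n.+1; split => //; first by rewrite leqnn leqW.
    have := H1 n (leq_trans N1n0 n0n); rewrite ler_norml => /andP[+ _]; lra.
  by move=> k /andP[nk kn]; move: (leq_trans kn nk); rewrite ltnn.
have := H2 s n (leq_trans N2n0 n0s) sn run; lra.
Qed.

End real_sequences.

(** * Convergence of centred sums weighted by the reciprocal of the total *)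

Section weighted_series.
Context {R : realType}.
Variables (a C : R) (y : nat -> R).
Hypotheses (a0 : 0 < a) (y0 : forall n, 0 < y n) (yS : forall n, y n <= y n.+1).
Hypothesis (yT : forall n,
  a * (\sum_(0 <= k < n) (y k)^-1) <= 2 * ln (y n) + C).

(* [r = y ^ (1/8)]: the sum [S_n] of the [d k] is of order [n ^ (3/4)] at most and
   [n] of order [r_n ^ 9], so that [S_n] is of order [r_n ^ 7 = y_n ^ (7/8)]. *)
Let r n := expR (ln (y n) / 8).

Let r0 n : 0 < r n. Proof. exact: expR_gt0. Qed.

Let r8 n : r n ^+ 8 = y n.
Proof. by rewrite -expRM_natl (_ : 8%:R * _ = ln (y n)) ?lnK// ?posrE//; field. Qed.

Let y_homo m n : (m <= n)%N -> y m <= y n.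
Proof. by move: m n; apply/nondecreasing_seqP. Qed.

Let r_homo m n : (m <= n)%N -> r m <= r n.
Proof.
by move=> mn; rewrite ler_expR ler_pM2r// ler_ln ?posrE// y_homo.
Qed.

(** The three summands pay for [ln (y n) <= 8 * r n], for the constant [C] and for the last term
    [(y n)^-1]; the latter two are absorbed because [r n / r 0 >= 1]. *)
Let K1 := 16 / a + `|C| / a / r 0%N + (y 0%N)^-1 / r 0%N.

Let K1_gt0 : 0 < K1.
Proof.
rewrite /K1 ltr_wpDr//; first by rewrite divr_ge0// ?invr_ge0 ltW.
by rewrite ltr_wpDr ?divr_gt0// !divr_ge0 ?normr_ge0// ltW.
Qed.

Let sum_inv_le n : \sum_(0 <= k < n.+1) (y k)^-1 <= K1 * r n.
Proof.
have rn : 1 <= r n / r 0%N by rewrite ler_pdivlMr// mul1r r_homo.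
have lny : ln (y n) <= 8 * r n.
  have -> : ln (y n) = 8 * ln (r n) by rewrite expRK; field.
  by rewrite ler_pM2l// ltW// ln_sublinear.
have T : \sum_(0 <= k < n) (y k)^-1 <= 16 / a * r n + `|C| / a * (r n / r 0%N).
  rewrite -(ler_pM2l a0) (le_trans (yT n))//.
  have -> : a * (16 / a * r n + `|C| / a * (r n / r 0%N)) =
            16 * r n + `|C| * (r n / r 0%N) by field; rewrite !gt_eqF.
  have C1 : C <= `|C| * (r n / r 0%N).
    by rewrite (le_trans (ler_norm C))// ler_peMr.
  lra.
rewrite big_nat_recr//= {1}/K1.
have yn : (y n)^-1 <= (y 0%N)^-1 * (r n / r 0%N).
  rewrite (@le_trans _ _ (y 0%N)^-1)//; last by rewrite ler_peMr// invr_ge0 ltW.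
  by rewrite lef_pV2 ?posrE// y_homo.
have -> : (16 / a + `|C| / a / r 0%N + (y 0%N)^-1 / r 0%N) * r n =
  16 / a * r n + `|C| / a * (r n / r 0%N) + (y 0%N)^-1 * (r n / r 0%N) by ring.
exact: lerD.
Qed.

(** As [y] is nondecreasing, each ratio [y n / y k] with [k <= n] is at least 1, so [n.+1] is at
    most [y n] times the sum of the reciprocals. *)
Let natr_le n : n.+1%:R <= K1 * r n ^+ 9.
Proof.
have -> : K1 * r n ^+ 9 = y n * (K1 * r n) by rewrite -r8; ring.
apply: (@le_trans _ _ (y n * \sum_(0 <= k < n.+1) (y k)^-1)); last first.
  by rewrite ler_pM2l// sum_inv_le.
rewrite mulr_sumr (_ : n.+1%:R = \sum_(0 <= k < n.+1) 1); last first.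
  by rewrite sumr_const_nat subn0.
rewrite !big_mkord; apply: ler_sum => k _.
by rewrite ler_pdivlMr// mul1r y_homo// -ltnS.
Qed.

Let p n := (r n)^-1.

Let p_gt0 n : 0 < p n. Proof. by rewrite invr_gt0. Qed.

(** By [natr_le], [p n ^+ 9] is at most [K1 / n.+1]; hence a rank read off from [K1 / e ^+ 9]. *)
Let p_small (e : R) : 0 < e -> exists N, forall n, (N <= n)%N -> p n <= e.
Proof.
move=> e0; have e9 : 0 < e ^+ 9 by rewrite exprn_gt0.
exists (Num.bound (K1 / e ^+ 9)) => n Nn.
rewrite -(@ler_pXn2r _ 9)// ?nnegrE ?(ltW (p_gt0 _)) ?(ltW e0)//.
rewrite (_ : p n ^+ 9 = 1 / r n ^+ 9); last by rewrite /p exprVn mul1r.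
rewrite ler_pdivrMr ?exprn_gt0//.
have : K1 / e ^+ 9 < n.+1%:R.
  rewrite (lt_le_trans (archi_boundP _))// ?divr_ge0// ?ltW//.
  by rewrite ltr_nat ltnS.
rewrite ltr_pdivrMr// => H; rewrite -(ler_pM2l K1_gt0) mulr1.
rewrite (_ : K1 * _ = (K1 * r n ^+ 9) * e ^+ 9); last by ring.
by rewrite (le_trans (ltW H))// ler_pM2r.
Qed.

Lemma total_unbounded (M : R) : exists N, forall n, (N <= n)%N -> M <= y n.
Proof.
have M1 : 0 < `|M| + 1 by rewrite ltr_wpDl.
have M1V : 0 < (`|M| + 1)^-1 by rewrite invr_gt0.
have [N HN] := p_small M1V.
exists N => n /HN; rewrite /p lef_pV2 ?posrE// => H.
rewrite (le_trans (ler_norm M))//.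
have : `|M| + 1 <= r n ^+ 8.
  rewrite (le_trans H)// -[leLHS]expr1 ler_weXn2l//.
  by rewrite (le_trans _ H)// lerDr.
rewrite r8; lra.
Qed.

(** After Abel summation the boundary term is at most [K * r ^ 7 / r ^ 8 = K * p], which vanishes,
    and the remaining series is dominated by the telescoping differences of [8 * K * p]. *)
Lemma is_cvg_weighted_series (d : nat -> R) :
  (exists D, forall n, (\sum_(0 <= k < n) d k) ^+ 4 <= D * n%:R ^+ 3) ->
  cvgn (fun n => \sum_(0 <= k < n) d k / y k).
Proof.
move=> [D HD].
pose S n := \sum_(0 <= k < n) d k.
(* [K >= 1] gives [K <= K ^+ 4], and the division by [r 0] buys one more power of [r n]: the fourth
   power of [K * r n ^+ 7] has degree 28 in [r n], against degree 27 for the cube of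
   [K1 * r n ^+ 9]. *)
pose K := 1 + `|D| * K1 ^+ 3 / r 0%N.
have DK0 : 0 <= `|D| * K1 ^+ 3 / r 0%N.
  by rewrite divr_ge0 ?(ltW (r0 _))// mulr_ge0// exprn_ge0// ltW.
have K0 : 1 <= K by rewrite lerDl.
have SK n : `|S n.+1| <= K * r n ^+ 7.
  have K00 : 0 <= K by rewrite (le_trans _ K0).
  rewrite -(@ler_pXn2r _ 4)// ?nnegrE ?mulr_ge0 ?exprn_ge0 ?(ltW (r0 _))//.
  rewrite -normrX ger0_norm ?exprn_even_ge0// (le_trans (HD _))//.
  apply: (@le_trans _ _ (`|D| * (K1 * r n ^+ 9) ^+ 3)).
    apply: (@le_trans _ _ (`|D| * n.+1%:R ^+ 3)).
      by rewrite ler_wpM2r ?exprn_ge0// ler_norm.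
    rewrite ler_wpM2l// lerXn2r ?nnegrE ?natr_le//.
    by rewrite mulr_ge0 ?exprn_ge0 ?(ltW K1_gt0) ?(ltW (r0 _)).
  rewrite (_ : `|D| * _ = `|D| * K1 ^+ 3 * r n ^+ 27); last by ring.
  rewrite exprMn -exprM (_ : (7 * 4 = 28)%N)//.
  rewrite (exprS _ 27) mulrA ler_pM2r ?exprn_gt0//.
  rewrite (@le_trans _ _ (K * r n))//; last first.
    by rewrite ler_pM2r// -[leLHS]expr1 ler_weXn2l.
  rewrite (@le_trans _ _ (`|D| * K1 ^+ 3 / r 0%N * r n))//; last first.
    by rewrite ler_pM2r// lerDr.
  rewrite -mulrA ler_peMr ?mulr_ge0 ?exprn_ge0 ?(ltW K1_gt0)//.
  by rewrite mulrC ler_pdivlMr// mul1r r_homo.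
rewrite (_ : (fun n => _) = (fun n => S n * (y n)^-1) \+
  (fun n => \sum_(0 <= k < n) S k.+1 * ((y k)^-1 - (y k.+1)^-1))); last first.
  by apply/funext => n; rewrite abel_summation.
apply: is_cvgD; last first.
  apply: (@is_cvg_series_telescope _ _ (fun k => 8 * K * p k)).
    by move=> n; rewrite mulr_ge0 ?mulr_ge0 ?(ltW (p_gt0 _))// (le_trans _ K0).
  move=> n; rewrite normrM.
  have pp : p n.+1 <= p n by rewrite lef_pV2 ?posrE// r_homo.
  have -> : (y n)^-1 - (y n.+1)^-1 = p n ^+ 8 - p n.+1 ^+ 8.
    by rewrite -!r8 /p !exprVn.
  (* The difference of eighth powers factors into [p n - p n.+1] and eight terms, each at most
     [p n ^+ 7]; this power cancels [r n ^+ 7] in the bound on [S]. *)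
  have p8 : 0 <= p n ^+ 8 - p n.+1 ^+ 8 <= 8 * p n ^+ 7 * (p n - p n.+1).
    rewrite subr_ge0 lerXn2r ?nnegrE ?(ltW (p_gt0 _))//=.
    rewrite subrXX mulrC ler_wpM2r ?subr_ge0//.
    rewrite mulrC -[8]/(8%:R) mulr_natr -[in X in _ *+ X](card_ord 8) -sumr_const.
    apply: ler_sum => i _.
    have -> : p n ^+ 7 = p n ^+ (8.-1 - i) * p n ^+ i.
      by rewrite -exprD subnK// -ltnS.
    rewrite ler_wpM2l ?exprn_ge0 ?(ltW (p_gt0 _))//.
    by rewrite lerXn2r ?nnegrE ?(ltW (p_gt0 _)).
  case/andP: p8 => p80 p8; rewrite (ger0_norm p80).
  apply: (@le_trans _ _ ((K * r n ^+ 7) * (8 * p n ^+ 7 * (p n - p n.+1)))).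
    exact: ler_pM.
  rewrite (_ : _ * _ = 8 * K * p n - 8 * K * p n.+1)//.
  rewrite /p; field; rewrite !gt_eqF//.
apply/cvg_ex; exists 0; apply/cvgrPdist_le => e e0.
have K00 : 0 < K by rewrite (lt_le_trans _ K0).
have [N HN] := p_small (divr_gt0 e0 K00).
exists N.+1 => // -[//|n] /= Nn; rewrite sub0r normrN normrM.
have pn : p n.+1 <= e / K by apply: HN; rewrite ltnW.
rewrite [X in _ * X]ger0_norm ?invr_ge0 ?(ltW (y0 _))//.
have -> : (y n.+1)^-1 = p n.+1 ^+ 8 by rewrite -r8 /p exprVn.
apply: (@le_trans _ _ (K * r n.+1 ^+ 7 * p n.+1 ^+ 8)).
  rewrite ler_wpM2r ?exprn_ge0 ?(ltW (p_gt0 _))// (le_trans (SK n))//.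
  by rewrite ler_wpM2l ?(ltW K00)// lerXn2r ?nnegrE ?(ltW (r0 _))// r_homo.
rewrite (_ : _ * _ = K * p n.+1); last first.
  by rewrite /p; field; rewrite gt_eqF.
by rewrite mulrC -ler_pdivlMr.
Qed.

End weighted_series.

(* One colour along a trajectory: [y] is the total, [c] the number of balls of
   this colour, [d] the rewards (also of the trials that do not add this colour),
   [w] the threshold test. *)
Record colour_path {R : realType} (a b m : R) (y c d : nat -> R)
    (w : nat -> bool) : Prop := ColourPath {
  colour_gt0 : forall n, 0 < c n ;
  colour_step : forall n, c n <= c n.+1 <= c n + b * (w n)%:R ;
  colour_reward : forall n, a <= d n <= b ;
  colour_ln : cvgn (fun n =>
    ln (c n) - \sum_(0 <= k < n) d k * (w k)%:R / y k) ;
  colour_dev : exists D, forall n,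
    (\sum_(0 <= k < n) (d k - m)) ^+ 4 <= D * n%:R ^+ 3 }.

Record urn_path {R : realType} (a b m1 m2 rho1 rho2 : R)
    (y y1 y2 d1 d2 rh1 rh2 : nat -> R) (w1 w2 : nat -> bool) : Prop := UrnPath {
  urn_total : forall n, y n = y1 n + y2 n ;
  urn_red : colour_path a b m1 y y1 d1 w1 ;
  urn_white : colour_path a b m2 y y2 d2 w2 ;
  urn_w1 : forall n, w1 n = (y1 n / y n <= rh1 n) ;
  urn_w2 : forall n, w2 n = (rh2 n <= y1 n / y n) ;
  urn_rh : forall n, rh2 n <= rh1 n ;
  urn_rh1 : rh1 @ \oo --> rho1 ;
  urn_rh2 : rh2 @ \oo --> rho2 }.

(** The white share is 1 minus the red one, so the exchange reverses the inequalities and makes each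
    threshold play the role of the other. Upper bounds on the share thus follow from lower
    bounds. *)
Lemma urn_path_swap {R : realType} (a b m1 m2 rho1 rho2 : R)
    (y y1 y2 d1 d2 rh1 rh2 : nat -> R) (w1 w2 : nat -> bool) :
  urn_path a b m1 m2 rho1 rho2 y y1 y2 d1 d2 rh1 rh2 w1 w2 ->
  urn_path a b m2 m1 (1 - rho2) (1 - rho1) y y2 y1 d2 d1
    (fun n => 1 - rh2 n) (fun n => 1 - rh1 n) w2 w1.
Proof.
move=> [yE c1 c2 w1E w2E rh r1 r2].
have zE n : y2 n / y n = 1 - y1 n / y n.
  have := colour_gt0 c1 n; have := colour_gt0 c2 n; rewrite yE => ? ?.
  field; rewrite gt_eqF//; lra.
split=> //.
- by move=> n; rewrite yE addrC.
- by move=> n; rewrite zE w2E lerD2l lerN2.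
- by move=> n; rewrite zE w1E lerD2l lerN2.
- by move=> n; rewrite lerD2l lerN2.
- by apply: cvgB => //; exact: cvg_cst.
- by apply: cvgB => //; exact: cvg_cst.
Qed.

(** * Pathwise bounds on the lower and upper limits of the share *)

Section urn_path_limits.
Context {R : realType}.
Variables (a b m1 m2 rho1 rho2 : R) (y y1 y2 d1 d2 rh1 rh2 : nat -> R).
Variables (w1 w2 : nat -> bool).
Hypothesis a0 : 0 < a.
Hypothesis up : urn_path a b m1 m2 rho1 rho2 y y1 y2 d1 d2 rh1 rh2 w1 w2.

Let z n := y1 n / y n.
Let T n := \sum_(0 <= k < n) (y k)^-1.
Let q n := ln (y1 n) - ln (y2 n).

Let y1_gt0 n : 0 < y1 n. Proof. exact: colour_gt0 (urn_red up) n. Qed.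
Let y2_gt0 n : 0 < y2 n. Proof. exact: colour_gt0 (urn_white up) n. Qed.
Let y_gt0 n : 0 < y n. Proof. by rewrite (urn_total up) addr_gt0. Qed.

Let b_gt0 : 0 < b.
Proof.
have /andP[ad db] := colour_reward (urn_red up) 0%N.
exact: lt_le_trans (le_trans ad db).
Qed.

Let y_nd n : y n <= y n.+1.
Proof.
rewrite !(urn_total up); have /andP[? _] := colour_step (urn_red up) n.
by have /andP[? _] := colour_step (urn_white up) n; exact: lerD.
Qed.

Let T_lb : exists C, forall n, a * T n <= 2 * ln (y n) + C.
Proof.
have [M1 [_ HM1]] := cvg_seq_bounded (colour_ln (urn_red up)).
have [M2 [_ HM2]] := cvg_seq_bounded (colour_ln (urn_white up)).
exists (`|M1| + 1 + (`|M2| + 1)) => n.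
have {}HM1 := HM1 (`|M1| + 1) (ltr_pwDr ltr01 (ler_norm _)) n I.
have {}HM2 := HM2 (`|M2| + 1) (ltr_pwDr ltr01 (ler_norm _)) n I.
move: HM1 HM2; rewrite /= !ler_norml => /andP[H1 _] /andP[H2 _].
have l1 : ln (y1 n) <= ln (y n).
  by rewrite ler_ln ?posrE// (urn_total up) lerDl ltW.
have l2 : ln (y2 n) <= ln (y n).
  by rewrite ler_ln ?posrE// (urn_total up) lerDr ltW.
have : a * T n <= \sum_(0 <= k < n) d1 k * (w1 k)%:R / y k +
                  \sum_(0 <= k < n) d2 k * (w2 k)%:R / y k.
  rewrite mulr_sumr -big_split/=; apply: ler_sum => k _.
  have key : a <= d1 k * (w1 k)%:R + d2 k * (w2 k)%:R.
    have /andP[D1 _] := colour_reward (urn_red up) k.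
    have /andP[D2 _] := colour_reward (urn_white up) k.
    have ow : w1 k || w2 k.
      rewrite (urn_w1 up) (urn_w2 up).
      have [//|/ltW H] := leP (y1 k / y k) (rh1 k).
      exact: le_trans (urn_rh up k) H.
    have ga0 := a0.
    by case: (w1 k) ow; case: (w2 k) => // _; rewrite ?mulr1 ?mulr0; lra.
  by rewrite -mulrDl ler_pM2r ?invr_gt0.
lra.
Qed.

Let y_unbounded M : exists N, forall n, (N <= n)%N -> M <= y n.
Proof. by have [C HC] := T_lb; apply: (total_unbounded a0 y_gt0 y_nd HC). Qed.

Let cvg_dev (m : R) (c d : nat -> R) w : colour_path a b m y c d w ->
  cvgn (fun n => \sum_(0 <= k < n) (d k - m) / y k).
Proof.
move=> /colour_dev cd; have [C HC] := T_lb.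
exact: (is_cvg_weighted_series a0 y_gt0 y_nd HC).
Qed.

(** Each colour gains at most [b] per step, so [ln (y n)] grows by at most [2 * b / y n]; since [y]
    is unbounded, so is [T]. *)
Let T_unbounded M : exists N, forall n, (N <= n)%N -> M <= T n.
Proof.
have ub n : ln (y n) <= ln (y 0%N) + 2 * b * T n.
  rewrite /T; elim: n => [|n IH]; first by rewrite big_geq// mulr0 addr0.
  rewrite big_nat_recr//= mulrDr addrA.
  have -> : ln (y n.+1) = ln (y n) + ln (1 + (y n.+1 - y n) / y n).
    rewrite -lnM ?posrE//.
      by congr ln; field; rewrite gt_eqF.
    by rewrite ltr_wpDr ?divr_ge0 ?subr_ge0 ?(ltW (y_gt0 _)).
  apply: lerD => //.
  have h : 0 <= (y n.+1 - y n) / y n by rewrite divr_ge0 ?subr_ge0 ?(ltW (y_gt0 _)).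
  rewrite (le_trans (le_ln1Dx _))//; first by lra.
  rewrite ler_pM2r ?invr_gt0//.
  rewrite !(urn_total up); have /andP[_ +] := colour_step (urn_red up) n.
  have /andP[_] := colour_step (urn_white up) n.
  have bw (w : bool) : b * w%:R <= b by case: w; rewrite ?mulr1 ?mulr0// ltW.
  by have := bw (w1 n); have := bw (w2 n); lra.
have [N HN] := y_unbounded (expR (ln (y 0%N) + 2 * b * M)).
exists N => n /HN; rewrite -[X in _ <= X](@lnK _ (y n)) ?posrE// ler_expR => H.
rewrite -(@ler_pM2l _ (2 * b)) ?mulr_gt0//.
have := ub n; lra.
Qed.

(** The increments of the convergent sequence in [colour_ln] vanish, and so does the compensating
    term, being at most [b / y n]. *)
Let ln_step (m : R) (c d : nat -> R) w : colour_path a b m y c d w ->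
  forall e, 0 < e -> exists N, forall n, (N <= n)%N ->
    `|ln (c n.+1) - ln (c n)| <= e.
Proof.
move=> cp e e0; have e20 : 0 < e / 2 by lra.
have [N1 HN1] := cvgn_osc (colour_ln cp) e20.
have [N2 HN2] := y_unbounded (b / (e / 2)).
exists (maxn N1 N2) => n; rewrite geq_max => /andP[n1 n2].
have := HN1 n n.+1 n1 (leqW n1); rewrite big_nat_recr//= => H1.
have dy : 0 <= d n * (w n)%:R / y n <= e / 2.
  have /andP[da db] := colour_reward cp n.
  rewrite divr_ge0 ?mulr_ge0 ?(ltW (y_gt0 _))//=; last by have := a0; lra.
  rewrite ler_pdivrMr// [leRHS]mulrC.
  have := HN2 n n2; rewrite ler_pdivrMr// => H.
  apply: le_trans H; case: (w n); rewrite ?mulr1// mulr0.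
  exact: ltW b_gt0.
move: H1 dy; rewrite !ler_norml => /andP[? ?] /andP[? ?].
by apply/andP; split; lra.
Qed.

Let q_step e : 0 < e -> exists N, forall n, (N <= n)%N -> `|q n.+1 - q n| <= e.
Proof.
move=> e0; have e20 : 0 < e / 2 by lra.
have [N1 HN1] := ln_step (urn_red up) e20.
have [N2 HN2] := ln_step (urn_white up) e20.
exists (maxn N1 N2) => n; rewrite geq_max => /andP[/HN1 + /HN2].
rewrite /q !ler_norml => /andP[? ?] /andP[? ?].
by apply/andP; split; lra.
Qed.

(** The logit; [q] is the logit of the share [z]. *)
Let lg (r : R) := ln (r / (1 - r)).

Let z_le r n : 0 < r -> r < 1 -> (z n <= r) = (q n <= lg r).
Proof.
move=> r0 r1; have r1' : 0 < 1 - r by rewrite subr_gt0.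
rewrite /q /lg -ln_div ?posrE// ler_ln ?posrE ?divr_gt0//.
rewrite /z ler_pdivrMr// ler_pdivrMr// mulrAC ler_pdivlMr// (urn_total up).
by rewrite -subr_ge0 -[RHS]subr_ge0; congr (0 <= _); ring.
Qed.

(** Two logarithmic laws and two centred reward sums converge, and each accounts for [e / 4]. While
    the red test succeeds, red receives its full reward weight and white at most its own. *)
Let drift e : 0 < e -> exists N, forall s t, (N <= s)%N -> (s <= t)%N ->
    (forall k, (s <= k < t)%N -> w1 k) ->
  (m1 - m2) * (T t - T s) - e <= q t - q s.
Proof.
move=> e0; have e40 : 0 < e / 4 by lra.
have [N1 H1] := cvgn_osc (colour_ln (urn_red up)) e40.
have [N2 H2] := cvgn_osc (colour_ln (urn_white up)) e40.
have [N3 H3] := cvgn_osc (cvg_dev (urn_red up)) e40.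
have [N4 H4] := cvgn_osc (cvg_dev (urn_white up)) e40.
exists (maxn (maxn N1 N2) (maxn N3 N4)) => s t.
rewrite !geq_max -!andbA => /and4P[n1 n2 n3 n4] st run.
have {}H1 := H1 s t n1 (leq_trans n1 st).
have {}H2 := H2 s t n2 (leq_trans n2 st).
have {}H3 := H3 s t n3 (leq_trans n3 st).
have {}H4 := H4 s t n4 (leq_trans n4 st).
have sumE (F : nat -> R) : \sum_(0 <= k < t) F k =
    \sum_(0 <= k < s) F k + \sum_(s <= k < t) F k.
  by rewrite -big_cat_nat.
move: H1 H2 H3 H4; rewrite /T /q !sumE !ler_norml.
have : \sum_(s <= k < t) (d1 k - m1) / y k - \sum_(s <= k < t) (d2 k - m2) / y k
   + (m1 - m2) * \sum_(s <= k < t) (y k)^-1 <=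
   \sum_(s <= k < t) d1 k * (w1 k)%:R / y k -
   \sum_(s <= k < t) d2 k * (w2 k)%:R / y k.
  rewrite mulr_sumr -!sumrB -big_split/= big_nat [leRHS]big_nat.
  apply: ler_sum => k kst; rewrite run// mulr1.
  have key : d1 k - m1 - (d2 k - m2) + (m1 - m2) <= d1 k - d2 k * (w2 k)%:R.
    have /andP[D2 _] := colour_reward (urn_white up) k.
    by have := a0; case: (w2 k); rewrite ?mulr1 ?mulr0; lra.
  by rewrite -!mulrBl -mulrDl ler_pM2r ?invr_gt0.
move=> ? /andP[? ?] /andP[? ?] /andP[? ?] /andP[? ?]; lra.
Qed.

(** This carries [liminf_ge_of_runs] from the logit back to the share; the tolerance is half the gap
    between the logits of [r'] and [r]. Levels [r' <= 0] are treated apart, as they have no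
    logit. *)
Let liminf_share (r : R) : 0 < r -> r < 1 ->
  (forall e, 0 < e -> exists N, forall s t, (N <= s)%N -> (s <= t)%N ->
     (forall k, (s <= k < t)%N -> z k <= r) -> q s - e <= q t) ->
  (forall N, exists2 n, (N <= n)%N & r < z n) ->
  forall r', r' < r -> exists N, forall n, (N <= n)%N -> r' <= z n.
Proof.
move=> r0 r1 runs io r' r'r.
have [r'0|r'0] := leP r' 0.
  by exists 0%N => n _; rewrite (le_trans r'0)// divr_ge0// ltW.
have r'1 : r' < 1 by exact: lt_trans r'r r1.
have lgr : lg r' < lg r.
  rewrite ltr_ln ?posrE ?divr_gt0 ?subr_gt0//.
  by rewrite ltr_pM ?ltW ?invr_gt0 ?subr_gt0// ltf_pV2 ?posrE ?subr_gt0//; lra.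
have e0 : 0 < (lg r - lg r') / 2 by lra.
have [N HN] : exists N, forall n, (N <= n)%N -> lg r - (lg r - lg r') / 2 <= q n.
  apply: liminf_ge_of_runs e0 => //.
    move=> e /runs[N HN]; exists N => s t Ns st H; apply: HN => // k kst.
    by rewrite z_le// H.
  move=> N; have [n Nn rz] := io N; exists n => //.
  by rewrite ltNge -z_le// -ltNge.
exists N => n /HN H.
rewrite leNgt; apply/negP => /ltW; rewrite z_le// => ?; lra.
Qed.

Let exceeds (r : R) : (~ exists N, forall n, (N <= n)%N -> z n <= r) ->
  forall N, exists2 n, (N <= n)%N & r < z n.
Proof.
move=> H N; apply: contra_notP H => H; exists N => n Nn.
by rewrite leNgt; apply/negP => rz; apply: H; exists n.
Qed.

(** Let [r'] lie between [r] and [rho2]. At late times with share at most [r'] the red test succeeds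
    and the white one fails, so white is frozen and [q] cannot decrease. The share cannot stay there
    forever, since [ln (y1 n)] would grow at least like [a * T n] with [y2] constant. *)
Lemma share_ge_lower_threshold r : rho2 <= 1 -> r < rho2 ->
  exists N, forall n, (N <= n)%N -> r <= z n.
Proof.
move=> rho21 rrho.
have [r0|r0] := leP r 0.
  by exists 0%N => n _; rewrite (le_trans r0)// divr_ge0// ltW.
pose r' := (r + rho2) / 2.
have rr' : r < r' by rewrite /r'; lra.
have r'rho : r' < rho2 by rewrite /r'; lra.
have r'1 : r' < 1 by lra.
have r'0 : 0 < r' by lra.
have [N0 _ HN0] := cvgr_gt _ (urn_rh2 up) _ r'rho.
have w k : (N0 <= k)%N -> z k <= r' -> w1 k && ~~ w2 k.
  move=> /HN0 /= rk zk; rewrite (urn_w1 up) (urn_w2 up) -ltNge.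
  rewrite (le_lt_trans zk)// andbT (le_trans zk)// (le_trans (ltW rk))//.
  exact: urn_rh up k.
apply: (@liminf_share r') rr' => //.
  move=> e e0; exists N0 => s t N0s st run.
  suff : q s <= q t by lra.
  elim: t st run => [|t IH]; first by rewrite leqn0 => /eqP ->.
  rewrite leq_eqVlt => /predU1P[->//|]; rewrite ltnS => st run.
  have qt : q s <= q t.
    by apply: IH => // k /andP[sk kt]; apply: run; rewrite sk leqW.
  have /andP[_ wt] : w1 t && ~~ w2 t.
    by apply: w; [exact: leq_trans st|apply: run; rewrite st/=].
  apply: (le_trans qt); rewrite /q.
  have /andP[h1 _] := colour_step (urn_red up) t.
  have /andP[h2 h3] := colour_step (urn_white up) t.
  move: h3; rewrite (negbTE wt) mulr0 addr0 => h3.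
  by rewrite lerB// ler_ln ?posrE.
apply: exceeds => -[N HN].
have e1 : (0 : R) < 1 by [].
have [N1 H1] := cvgn_osc (colour_ln (urn_red up)) e1.
pose s := maxn N0 (maxn N N1).
(* With the margin 3, the growth of [q] still exceeds [lg r' - q s] after the oscillation 1 of the
   red law is subtracted, against [q t <= lg r']. *)
have [N2 H2] := T_unbounded (T s + (lg r' - q s + 3) / a).
pose t := maxn s N2.
have st : (s <= t)%N by rewrite leq_maxl.
have N1s : (N1 <= s)%N by rewrite /s !leq_max leqnn ?orbT.
have Ns : (N <= s)%N by rewrite /s !leq_max leqnn ?orbT.
have N0s : (N0 <= s)%N by rewrite /s !leq_max leqnn.
have := H1 s t N1s (leq_trans N1s st).
have ws k : (s <= k)%N -> w1 k && ~~ w2 k.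
  by move=> sk; apply: w; [exact: leq_trans sk|apply: HN; exact: leq_trans sk].
have y2s : y2 t = y2 s.
  have : forall n, (s <= n)%N -> y2 n = y2 s.
    elim=> [|n IH]; first by rewrite leqn0 => /eqP ->.
    rewrite leq_eqVlt => /predU1P[->//|]; rewrite ltnS => sn.
    rewrite -IH//; have /andP[_ wn] := ws n sn.
    have := colour_step (urn_white up) n.
    by rewrite (negbTE wn) mulr0 addr0 -eq_le eq_sym => /eqP.
  exact.
have qt : q t <= lg r' by rewrite -z_le// HN// (leq_trans Ns).
have Tt := H2 t (leq_maxr _ _).
have sumE (F : nat -> R) : \sum_(0 <= k < t) F k =
    \sum_(0 <= k < s) F k + \sum_(s <= k < t) F k.
  by rewrite -big_cat_nat.
have drift1 : a * (T t - T s) <= \sum_(s <= k < t) d1 k * (w1 k)%:R / y k.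
  rewrite /T sumE addrAC subrr add0r mulr_sumr big_nat [leRHS]big_nat.
  apply: ler_sum => k /andP[/ws/andP[-> _] _]; rewrite mulr1 ler_pM2r ?invr_gt0//.
  by have /andP[] := colour_reward (urn_red up) k.
have aT : lg r' - q s + 3 <= a * (T t - T s).
  by rewrite mulrC -ler_pdivrMr//; lra.
move: qt; rewrite /q y2s sumE ler_norml => qt /andP[H _].
move: aT; rewrite /q; lra.
Qed.

(** Below a level [r < rho1] the red test eventually succeeds, and [drift] with [m2 <= m1] makes [q]
    almost nondecreasing along runs below [r]. Hence a level exceeded infinitely often is also, up
    to any loss, a lower bound in the long run. *)
Lemma share_ge_limsup r : m2 <= m1 -> rho1 <= 1 -> r < rho1 ->
  (forall N, exists2 n, (N <= n)%N & r < z n) ->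
  forall r', r' < r -> exists N, forall n, (N <= n)%N -> r' <= z n.
Proof.
move=> m21 rho11 rrho io r' r'r.
have [r0|r0] := leP r 0.
  exists 0%N => n _; rewrite (le_trans (ltW r'r))// (le_trans r0)//.
  by rewrite divr_ge0// ltW.
have r1 : r < 1 by lra.
apply: (liminf_share r0) r'r => // e /drift[N1 H1].
have [N2 _ HN2] := cvgr_gt _ (urn_rh1 up) _ rrho.
exists (maxn N1 N2) => s t; rewrite geq_max => /andP[N1s N2s] st run.
have := H1 s t N1s st; rewrite lerBlDr => H.
have {}H : (m1 - m2) * (T t - T s) <= q t - q s + e.
  apply: H => k /andP[sk kt]; rewrite (urn_w1 up).
  rewrite (le_trans (run k _)) ?sk// ltW//; apply: HN2; exact: leq_trans sk.
have : 0 <= (m1 - m2) * (T t - T s).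
  rewrite mulr_ge0 ?subr_ge0// /T (big_cat_nat _ st)//= lerDl.
  by rewrite sumr_ge0// => k _; rewrite invr_ge0 ltW.
lra.
Qed.

(** If the share stayed below [r], the drift of rate [m1 - m2 > 0] against the unbounded clock [T]
    would push [q] beyond [lg r]. *)
Lemma share_exceeds r : m2 < m1 -> rho1 <= 1 -> 0 < r -> r < rho1 ->
  forall N, exists2 n, (N <= n)%N & r < z n.
Proof.
move=> m21 rho11 r0 rrho; have r1 : r < 1 by lra.
apply: exceeds => -[N HN].
have [N1 H1] := drift ltr01.
have [N2 _ HN2] := cvgr_gt _ (urn_rh1 up) _ rrho.
pose s := maxn N (maxn N1 N2).
have [N3 H3] := T_unbounded (T s + (lg r - q s + 2) / (m1 - m2)).
pose t := maxn s N3.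
have st : (s <= t)%N by rewrite leq_maxl.
have Ns : (N <= s)%N by rewrite /s !leq_max leqnn ?orbT.
have N1s : (N1 <= s)%N by rewrite /s !leq_max leqnn ?orbT.
have N2s : (N2 <= s)%N by rewrite /s !leq_max leqnn ?orbT.
have H : (m1 - m2) * (T t - T s) - 1 <= q t - q s.
  apply: H1 => // k /andP[sk kt]; rewrite (urn_w1 up).
  rewrite (le_trans (HN k (leq_trans Ns sk)))// ltW//.
  by apply: HN2; exact: leq_trans sk.
have qt : q t <= lg r by rewrite -z_le// HN// (leq_trans Ns).
have Tt := H3 t (leq_maxr _ _).
have : lg r - q s + 2 <= (m1 - m2) * (T t - T s).
  by rewrite mulrC -ler_pdivrMr ?subr_gt0//; lra.
lra.
Qed.

End urn_path_limits.

(** The limit is the lower limit of the share, built as the supremum [l] of its eventual lower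
    bounds. No level strictly between [l] and [rho1] is exceeded infinitely often, and the upper
    limit is at most [rho1], so the upper limit is [l] as well. *)
Theorem urn_path_cvg {R : realType} (a b m1 m2 rho1 rho2 : R)
    (y y1 y2 d1 d2 rh1 rh2 : nat -> R) (w1 w2 : nat -> bool) :
  0 < a -> m2 <= m1 -> 0 <= rho2 -> rho2 <= rho1 -> rho1 <= 1 ->
  urn_path a b m1 m2 rho1 rho2 y y1 y2 d1 d2 rh1 rh2 w1 w2 ->
  exists l, [/\ (fun n => y1 n / y n) @ \oo --> l, rho2 <= l <= rho1 &
    m2 < m1 -> l = rho1].
Proof.
move=> a0 m21 rho20 rho21 rho11 up.
pose z n := y1 n / y n.
have y_gt0 n : 0 < y n.
  rewrite (urn_total up) addr_gt0//; first exact: colour_gt0 (urn_red up) n.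
  exact: colour_gt0 (urn_white up) n.
have z_ge0 n : 0 <= z n.
  by rewrite divr_ge0 ?(ltW (y_gt0 n))// ltW// (colour_gt0 (urn_red up)).
(* This is the lower bound by the lower threshold, applied to the urn with colours exchanged. *)
have z_upper r : rho1 < r -> exists N, forall n, (N <= n)%N -> z n <= r.
  move=> rhor; have rho1' : 1 - rho1 <= 1 by lra.
  have r' : 1 - r < 1 - rho1 by lra.
  have [N HN] := share_ge_lower_threshold a0 (urn_path_swap up) rho1' r'.
  exists N => n /HN; have -> : y2 n / y n = 1 - z n.
    rewrite /z; have := urn_total up n; have := y_gt0 n => ? e.
    by field: e; rewrite gt_eqF.
  lra.
pose A := [set r : R | exists N, forall n, (N <= n)%N -> r <= z n].
have A0 : A 0 by exists 0%N.
have A_ub r : A r -> r <= rho1.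
  move=> [N HN]; rewrite leNgt; apply/negP => rhor.
  have [M HM] := z_upper ((r + rho1) / 2) ltac:(lra).
  have := HN _ (leq_maxl N M); have := HM _ (leq_maxr N M); lra.
have A_sup : has_sup A by split; [exists 0|exists rho1].
pose l := sup A.
have l_le : l <= rho1 by apply: ge_sup => //; exists 0.
have A_le r : A r -> r <= l by move=> Ar; exact: ub_le_sup (A_sup.2) _ Ar.
have l_ge : rho2 <= l.
  apply/ler_addgt0Pl => e e0; rewrite -lerBlDl.
  by apply: A_le; apply: (share_ge_lower_threshold a0 up); lra.
have A_lt r : r < l -> A r.
  move=> rl; have e0 : 0 < l - r by rewrite subr_gt0.
  have [r' [N HN] r'l] := sup_adherent e0 A_sup.
  exists N => n /HN; move: r'l; rewrite -/l; lra.
have l_top r : l < r -> r < rho1 -> ~ (forall N, exists2 n, (N <= n)%N & r < z n).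
  move=> lr rrho io.
  have := share_ge_limsup a0 up m21 rho11 rrho io.
  move=> /(_ ((l + r) / 2) ltac:(lra)) /A_le; lra.
exists l; split; last 2 first.
- by rewrite l_ge l_le.
- move=> m21'; apply/eqP; rewrite eq_le l_le/= leNgt; apply/negP => lrho.
  apply: (l_top ((l + rho1) / 2)); [lra|lra|].
  apply: (share_exceeds a0 up) => //; last by lra.
  have := A_le _ A0; lra.
apply/cvgrPdist_le => e e0.
have [N1 H1] := A_lt (l - e) ltac:(lra).
have [N2 H2] : exists N, forall n, (N <= n)%N -> z n <= l + e.
  have [lrho|rhol] := ltP l rho1; last by apply: z_upper; lra.
  (* The midpoint keeps the level strictly between [l] and [rho1], as [l_top] requires. *)
  pose r := Num.min (l + e) ((l + rho1) / 2).
  have lr : l < r by rewrite lt_min; apply/andP; split; lra.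
  have rrho : r < rho1 by rewrite gt_min; apply/orP; right; lra.
  have re : r <= l + e by rewrite ge_min lexx.
  apply: contra_notP (l_top r lr rrho) => nex N.
  apply: contra_notP nex => nex; exists N => n Nn.
  rewrite (le_trans _ re)// leNgt; apply/negP => rz; apply: nex; by exists n.
exists (maxn N1 N2) => // n /=; rewrite geq_max => /andP[/H1 h1 /H2 h2].
by rewrite ler_norml -/(z n); apply/andP; split; lra.
Qed.

(** * Square-integrable martingales *)

Section bounded_variables.
Context {R : realType} {d : measure_display} {T : measurableType d}.

(** Boundedness everywhere keeps all products and powers integrable. Read over a type
    [g_sigma_algebraType G], the same predicate says that the variable is known from [G]. *)
Definition bounded_mfun (f : T -> R) :=
  measurable_fun setT f /\ exists M, forall w, `|f w| <= M.

Lemma bounded_mfunD f g : bounded_mfun f -> bounded_mfun g ->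
  bounded_mfun (fun w => f w + g w).
Proof.
move=> [mf [M fM]] [mg [N gN]]; split; first exact: measurable_funD.
by exists (M + N) => w; rewrite (le_trans (ler_normD _ _))// lerD.
Qed.

Lemma bounded_mfunM f g : bounded_mfun f -> bounded_mfun g ->
  bounded_mfun (fun w => f w * g w).
Proof.
move=> [mf [M fM]] [mg [N gN]]; split; first exact: measurable_funM.
by exists (M * N) => w; rewrite normrM ler_pM.
Qed.

Lemma bounded_mfun_cst r : bounded_mfun (fun=> r).
Proof. by split; [exact: measurable_cst|exists `|r|]. Qed.

Lemma bounded_mfunX f n : bounded_mfun f -> bounded_mfun (fun w => f w ^+ n).
Proof.
move=> bf; elim: n => [|n IH]; first exact: bounded_mfun_cst.
rewrite (_ : (fun w => _) = (fun w => f w * f w ^+ n)); last first.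
  by apply/funext => w; rewrite exprS.
exact: bounded_mfunM.
Qed.

Lemma bounded_mfunB f g : bounded_mfun f -> bounded_mfun g ->
  bounded_mfun (fun w => f w - g w).
Proof.
move=> bf bg; rewrite (_ : (fun w => _) = (fun w => f w + -1 * g w)); last first.
  by apply/funext => w; rewrite mulN1r.
by apply: bounded_mfunD => //; apply: bounded_mfunM => //; exact: bounded_mfun_cst.
Qed.

Lemma bounded_mfun_sum (f : nat -> T -> R) m n : (forall k, bounded_mfun (f k)) ->
  bounded_mfun (fun w => \sum_(m <= k < n) f k w).
Proof.
move=> bf; elim: (index_iota m n) => [|k s IH].
  rewrite (_ : (fun w => _) = fun=> 0); first exact: bounded_mfun_cst.
  by apply/funext => w; rewrite big_nil.
rewrite (_ : (fun w => _) = (fun w => f k w + \sum_(i <- s) f i w)); last first.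
  by apply/funext => w; rewrite big_cons.
exact: bounded_mfunD.
Qed.

Lemma bounded_mfun_indicator (b : T -> bool) : measurable_fun setT b ->
  bounded_mfun (fun w => (b w)%:R).
Proof.
move=> mb; split; last first.
  by exists 1 => w; case: (b w); rewrite ?normr1 ?normr0.
rewrite (_ : (fun w => _) = (fun w => if b w then 1 else 0)); last first.
  by apply/funext => w; case: (b w).
exact: measurable_fun_ifT.
Qed.

Variable P : probability T R.

Lemma bounded_mfun_integrable f : bounded_mfun f ->
  P.-integrable setT (EFin \o f).
Proof.
move=> [mf [M fM]]; apply: measurable_bounded_integrable => //.
  by rewrite /= probability_setT ltry.
exists M; split; first exact: num_real.
by move=> x Mx w _ /=; rewrite (le_trans (fM w))// ltW.
Qed.

Lemma Rintegral_expand f g : bounded_mfun f -> bounded_mfun g ->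
  \int[P]_w (f w + g w) ^+ 2 =
  \int[P]_w (f w ^+ 2) + 2 * \int[P]_w (f w * g w) + \int[P]_w (g w ^+ 2).
Proof.
move=> bf bg.
have If := bounded_mfun_integrable (bounded_mfunX 2 bf).
have Ig := bounded_mfun_integrable (bounded_mfunX 2 bg).
have Ifg := bounded_mfun_integrable (bounded_mfunM bf bg).
have I2 := bounded_mfun_integrable
  (bounded_mfunM (bounded_mfun_cst 2) (bounded_mfunM bf bg)).
have I3 := bounded_mfun_integrable (bounded_mfunD (bounded_mfunX 2 bf)
  (bounded_mfunM (bounded_mfun_cst 2) (bounded_mfunM bf bg))).
rewrite -RintegralZl// -RintegralD// -RintegralD//.
by apply: eq_Rintegral => w _; ring.
Qed.

Lemma chebyshev_bounded f (c : R) : 0 < c -> bounded_mfun f ->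
  (P [set w | (c <= `|f w|)%R] <= ((\int[P]_w (f w ^+ 2)) / c ^+ 2)%:E)%E.
Proof.
move=> c0 bf.
have mA : measurable [set w | c <= `|f w|].
  rewrite -[X in measurable X]setTI; apply: measurable_fun_ler => //.
  by apply: measurableT_comp => //; exact: bf.1.
have pfin : P [set w | c <= `|f w|] \is a fin_num by exact: fin_num_measure.
rewrite -(fineK pfin) lee_fin ler_pdivlMr ?exprn_gt0// mulrC.
have <- : \int[P]_w (\1_[set w | c <= `|f w|] w) = fine (P [set w | c <= `|f w|]).
  by rewrite /Rintegral integral_indic// setIT.
have b1 : bounded_mfun (\1_[set w | c <= `|f w|] : T -> R).
  split; first exact: measurable_indic.
  by exists 1 => w; rewrite indicE; case: (_ \in _); rewrite ?normr1 ?normr0.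
rewrite -RintegralZl//; last exact: bounded_mfun_integrable.
apply: le_Rintegral => //.
- exact: bounded_mfun_integrable (bounded_mfunM (bounded_mfun_cst _) b1).
- exact: bounded_mfun_integrable (bounded_mfunX 2 bf).
move=> w _; rewrite indicE; case: (boolP (w \in _)) => [|_]; last first.
  by rewrite mulr0 sqr_ge0.
rewrite inE/= mulr1 => cf.
have -> : f w ^+ 2 = `|f w| ^+ 2 by rewrite real_normK ?num_real.
by rewrite lerXn2r ?nnegrE// ltW.
Qed.

End bounded_variables.

(** * Almost sure convergence of martingales bounded in L^2 *)

Section l2_martingale.
Context {R : realType} {d : measure_display} {T : measurableType d}.
Variable P : probability T R.

Lemma bounded_mfun_sub (G : set (set T)) (f : T -> R) : G `<=` measurable ->
  bounded_mfun (f : g_sigma_algebraType G -> R) -> bounded_mfun f.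
Proof.
move=> Gm [mf fM]; split => // _ B mB; rewrite setTI.
have := mf measurableT B mB; rewrite setTI.
by apply: smallest_sub => //; exact: sigma_algebra_measurable.
Qed.

Lemma bounded_mfun_mono (G G' : set (set T)) (f : T -> R) : G `<=` <<s G' >> ->
  bounded_mfun (f : g_sigma_algebraType G -> R) ->
  bounded_mfun (f : g_sigma_algebraType G' -> R).
Proof.
move=> GG' [mf fM]; split => // _ B mB; rewrite setTI.
have := mf measurableT B mB; rewrite setTI.
by apply: smallest_sub => //; exact: smallest_sigma_algebra.
Qed.

Variables (G : nat -> set (set T)) (x : nat -> T -> R).
Hypothesis Gm : forall k, G k `<=` measurable.
Hypothesis GS : forall k, G k `<=` <<s G k.+1 >>.
Hypothesis bx : forall k, bounded_mfun (x k : g_sigma_algebraType (G k.+1) -> R).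
(** The martingale property, stated without conditional expectations: [x k] has conditional mean
    zero given [G k]. *)
Hypothesis orth : forall k h, bounded_mfun (h : g_sigma_algebraType (G k) -> R) ->
  \int[P]_w (h w * x k w) = 0.

(* Partial sums of the increments from rank [s], frozen once they leave
   [-c, c]. *)
Fixpoint stopped (c : R) (s j : nat) (w : T) : R :=
  if j is j'.+1 then
    stopped c s j' w + (`|stopped c s j' w| < c)%R%:R * x (s + j')%N w
  else 0.

Let bounded_stopped c s j :
  bounded_mfun (stopped c s j : g_sigma_algebraType (G (s + j)) -> R).
Proof.
elim: j => [|j IH]; first exact: bounded_mfun_cst.
rewrite addnS; apply: bounded_mfunD.
  exact: bounded_mfun_mono (@GS _) IH.
apply: bounded_mfunM => //.
apply: (bounded_mfun_mono (@GS _)); apply: bounded_mfun_indicator.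
apply: measurable_fun_ltr => //.
by apply: measurableT_comp => //; exact: IH.1.
Qed.

Let bxT k : bounded_mfun (x k).
Proof. exact: bounded_mfun_sub (@Gm _) (bx k). Qed.

Let stoppedT c s j : bounded_mfun (stopped c s j).
Proof. exact: bounded_mfun_sub (@Gm _) (bounded_stopped c s j). Qed.

Let indT c s j : bounded_mfun
  ((fun w => (`|stopped c s j w| < c)%R%:R) : g_sigma_algebraType (G (s + j)) -> R).
Proof.
apply: bounded_mfun_indicator; apply: measurable_fun_ltr => //.
by apply: measurableT_comp => //; exact: (bounded_stopped c s j).1.
Qed.

Lemma stopped_second_moment c s j :
  \int[P]_w (stopped c s j w ^+ 2) <=
  \sum_(s <= k < s + j) \int[P]_w (x k w ^+ 2).
Proof.
elim: j => [|j IH].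
  rewrite addn0 big_geq// le_eqVlt; apply/orP; left; apply/eqP => /=.
  rewrite (_ : (fun w => _) = fun=> 0); last by apply/funext => w; rewrite expr0n.
  by rewrite Rintegral_cst// mul0r.
rewrite addnS big_nat_recr/= ?leq_addr//.
have bi := bounded_mfun_sub (@Gm _) (indT c s j).
have bix := bounded_mfunM bi (bxT (s + j)).
rewrite (Rintegral_expand P (stoppedT c s j) bix).
have -> : \int[P]_w (stopped c s j w *
    ((`|stopped c s j w| < c)%R%:R * x (s + j)%N w)) = 0.
  rewrite -[RHS](orth (bounded_mfunM (bounded_stopped c s j) (indT c s j))).
  by apply: eq_Rintegral => w _; rewrite mulrA.
rewrite mulr0 addr0; apply: lerD => //.
apply: le_Rintegral => //.
- exact: bounded_mfun_integrable (bounded_mfunX 2 bix).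
- exact: bounded_mfun_integrable (bounded_mfunX 2 (bxT _)).
move=> w _; rewrite exprMn -[leRHS]mul1r ler_wpM2r ?sqr_ge0//.
by case: (_ < c); rewrite ?expr1n// expr0n.
Qed.

(** A frozen sum never comes back below [c], so a final value below [c] shows that freezing never
    occurred. Chebyshev at the final time then controls the maximum of the partial sums. *)
Lemma stopped_lt c s j w : `|stopped c s j w| < c ->
  forall i, (i <= j)%N -> `|\sum_(s <= k < s + i) x k w| < c.
Proof.
suff H : `|stopped c s j w| < c ->
    stopped c s j w = \sum_(s <= k < s + j) x k w /\
    forall i, (i < j)%N -> `|\sum_(s <= k < s + i) x k w| < c.
  move=> /[dup] /H[e H'] lt i; rewrite leq_eqVlt => /predU1P[->|/H'//].
  by rewrite -e.
elim: j => [|j IH] /=; first by rewrite addn0 big_geq.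
have [lt|ge] := ltP `|stopped c s j w| c; last first.
  by rewrite mul0r addr0 => /(le_lt_trans ge); rewrite ltxx.
rewrite mul1r => _; have [e H] := IH lt.
rewrite e addnS big_nat_recr/= ?leq_addr//; split => // i.
by rewrite ltnS leq_eqVlt => /predU1P[->|/H//]; rewrite -e.
Qed.

(** The probability that the sums ever move by [c] after rank [s] is at most the tail of the
    variances from [s] divided by [c ^+ 2], hence arbitrarily small. Taking [c = 1 / n.+1] for all
    [n] makes almost every path Cauchy. *)
Lemma l2_martingale_cvg :
  (exists C, forall n, \sum_(0 <= k < n) \int[P]_w (x k w ^+ 2) <= C) ->
  {ae P, forall w, cvgn (fun n => \sum_(0 <= k < n) x k w)}.
Proof.
move=> [C HC].
pose v n := \sum_(0 <= k < n) \int[P]_w (x k w ^+ 2).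
have cv : cvgn v.
  apply: nondecreasing_is_cvgn.
    apply/nondecreasing_seqP => n; rewrite /v big_nat_recr//= lerDl.
    by apply: Rintegral_ge0 => w _; exact: sqr_ge0.
  by exists C => _ [n _ <-]; exact: HC.
have vE s i : v (s + i)%N - v s = \sum_(s <= k < s + i) \int[P]_w (x k w ^+ 2).
  by rewrite /v (big_cat_nat _ (leq_addr i s))//= addrAC subrr add0r.
pose B (c : R) s j := [set w | (c <= `|stopped c s j w|)%R].
have mB c s j : measurable (B c s j).
  rewrite -[X in measurable X]setTI; apply: measurable_fun_ler => //.
  by apply: measurableT_comp => //; exact: (stoppedT c s j).1.
(* Frozen sums stay put, so the events increase with [j] and the bound passes to their union. *)
have ndB c s : nondecreasing_seq (B c s).
  apply/nondecreasing_seqP => j; apply/subsetPset => w; rewrite /B /= => cw.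
  by rewrite ltNge cw mul0r addr0.
have key (c : R) : 0 < c ->
    {ae P, forall w, exists s, forall i, `|\sum_(s <= k < s + i) x k w| < c}.
  move=> c0; exists (\bigcap_s \bigcup_j B c s j).
  have mU s : measurable (\bigcup_j B c s j) by exact: bigcupT_measurable.
  have mI : measurable (\bigcap_s \bigcup_j B c s j) by exact: bigcapT_measurable.
  split=> //.
    apply/eqP; rewrite eq_le measure_ge0 andbT.
    apply/lee_addgt0Pr => e e0; rewrite add0e.
    have ce0 : 0 < e * c ^+ 2 by rewrite mulr_gt0// exprn_gt0.
    have [s Hs] := cvgn_osc cv ce0.
    apply: (@le_trans _ _ (P (\bigcup_j B c s j))).
      by apply: le_measure; rewrite ?inE//; exact: bigcap_inf.
    have cP := @nondecreasing_cvg_mu _ _ _ P _ (mB c s) (mU s) (ndB c s).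
    have /cvg_lim <- // := cP.
    apply: lime_le.
      by apply/cvg_ex; eexists; exact: cP.
    apply: nearW => j /=.
    apply: (le_trans (chebyshev_bounded P c0 (stoppedT c s j))).
    rewrite lee_fin ler_pdivrMr ?exprn_gt0//.
    rewrite (le_trans (stopped_second_moment _ _ _))// -vE.
    exact: le_trans (ler_norm _) (Hs s (s + j)%N (leqnn _) (leq_addr _ _)).
  move=> w /= nex s _; apply: contrapT => nB; apply: nex; exists s => i.
  have : `|stopped c s i w| < c.
    by rewrite ltNge; apply/negP => h; apply: nB; exists i.
  by move=> /stopped_lt; apply.
have : {ae P, forall w, forall n : nat, exists s, forall i,
    `|\sum_(s <= k < s + i) x k w| < n.+1%:R^-1}.
  by apply: ae_foralln => n; apply: key; rewrite invr_gt0.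
apply: filterS => w H; apply: cauchy_cvg; apply: cauchy_exP => e e0.
have [n _ Hn] := near_infty_natSinv_lt (PosNum e0).
have [s Hs] := H n; exists (\sum_(0 <= k < s) x k w); exists s => // t /= st.
rewrite /ball/= distrC (big_cat_nat _ st)//= addrAC subrr add0r -(subnKC st).
exact: lt_trans (Hs _) (Hn n (leqnn _)).
Qed.

End l2_martingale.

(** * Independence *)

(** The joint law and the product of the marginal laws agree on rectangles, hence coincide, and
    Tonelli applies. *)
Lemma ge0_integral_indep {R : realType} {d d1 d2} {T : measurableType d}
    {T1 : measurableType d1} {T2 : measurableType d2} (P : probability T R)
    (V : T -> T1) (W : T -> T2) (f : T1 * T2 -> \bar R) :
  measurable_fun setT V -> measurable_fun setT W ->
  (forall A B, measurable A -> measurable B ->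
     P (V @^-1` A `&` W @^-1` B) = (P (V @^-1` A) * P (W @^-1` B))%E) ->
  measurable_fun setT f -> (forall v, (0 <= f v)%E) ->
  (\int[P]_w f (V w, W w) = \int[P]_w \int[P]_v f (V v, W w))%E.
Proof.
move=> mV mW VW mf f0.
pose V' : {mfun T >-> T1} := HB.pack V (isMeasurableFun.Build _ _ _ _ V mV).
pose W' : {mfun T >-> T2} := HB.pack W (isMeasurableFun.Build _ _ _ _ W mW).
have mVW : measurable_fun setT (fun w => (V w, W w)) by exact: measurable_fun_pair.
pose VW' : {mfun T >-> (T1 * T2)%type} :=
  HB.pack (fun w => (V w, W w)) (isMeasurableFun.Build _ _ _ _ _ mVW).
have := @ge0_integral_distribution _ _ _ _ _ P VW' f mf f0; rewrite /comp/= => <-.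
rewrite (@eq_measure_integral _ _ _ _
  (distribution P V' \x distribution P W')%E); last first.
  by move=> A mA _; apply/esym/product_measure_unique.
rewrite fubini_tonelli2// /fubini_G.
rewrite (@ge0_integral_distribution _ _ _ _ _ P W'); last 2 first.
- exact: measurable_fun_fubini_tonelli_G.
- by move=> y; exact: integral_ge0.
apply: eq_integral => w _ /=.
rewrite (@ge0_integral_distribution _ _ _ _ _ P V')//.
exact: measurable_fun_pair1.
Qed.

Lemma uniform_cdf {R : realType} (z : R) : 0 <= z <= 1 ->
  lebesgue_measure (`]-oo, z] `&` `]0, 1[ : set R) = z%:E.
Proof.
move=> /andP[z0]; rewrite le_eqVlt => /predU1P[->|z1].
  rewrite setIidr; last by move=> x /=; rewrite !in_itv/= => /andP[_ /ltW].
  by rewrite lebesgue_measure_itv/= lte_fin ltr01 sube0.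
rewrite (_ : _ `&` _ = `]0, z]%classic).
  rewrite lebesgue_measure_itv/= lte_fin; case: ltP => [_|z0']; first by rewrite sube0.
  by congr (_%:E); apply/eqP; rewrite eq_le z0.
apply/seteqP; split => x /=; rewrite !in_itv/=.
  by move=> [-> /andP[-> _]].
by move=> /andP[-> xz]; split => //; rewrite (le_lt_trans xz).
Qed.

(** * A fresh uniform variable compared with a level known from the past *)

Section uniform_threshold.
Context {R : realType} {d : measure_display} {T : measurableType d}.
Variables (P : probability T R) (G : set (set T)) (U : T -> R).
Hypothesis mU : measurable_fun setT U.
Hypothesis Gm : G `<=` measurable.
Hypothesis U_unif : forall B, measurable B ->
  P (U @^-1` B) = lebesgue_measure (B `&` `]0, 1[).
Hypothesis UG : forall A B, measurable A -> <<s G >> B ->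
  P (U @^-1` A `&` B) = (P (U @^-1` A) * P B)%E.

(** With the past held fixed, integrating the indicator of [U <= Z] over [U] yields [Z]. The
    absolute value makes the integrand nonnegative, as Tonelli asks. *)
Let orth_norm (Z h : T -> R) : (forall w, 0 <= Z w <= 1) ->
  bounded_mfun (Z : g_sigma_algebraType G -> R) ->
  bounded_mfun (h : g_sigma_algebraType G -> R) ->
  \int[P]_w ((U w <= Z w)%R%:R * `|h w|) = \int[P]_w (Z w * `|h w|).
Proof.
move=> Z01 bZ bh; rewrite /Rintegral; congr fine.
pose f (v : R * (R * R)) : \bar R := ((v.1 <= v.2.1)%R%:R * `|v.2.2|)%:E.
have mf : measurable_fun setT f.
  apply/measurable_EFinP; apply: measurable_funM.
    rewrite (_ : (fun v : R * (R * R) => _) =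
        (fun v => if (v.1 <= v.2.1)%R then 1 else 0)); last first.
      by apply/funext => v; case: ifP.
    apply: measurable_fun_ifT => //; apply: measurable_fun_ler => //.
    exact: measurableT_comp.
  by apply: measurableT_comp => //; exact: measurableT_comp.
have mZ := (bounded_mfun_sub Gm bZ).1; have mh := (bounded_mfun_sub Gm bh).1.
rewrite (@ge0_integral_indep _ _ _ _ _ _ _ P U (fun w => (Z w, h w)) f) => //.
- apply: eq_integral => w _ /=; rewrite /f/=.
  under eq_integral do rewrite mulrC EFinM.
  rewrite ge0_integralZl//=.
  + rewrite (_ : (fun v => (_)%:E) = EFin \o \1_(U @^-1` `]-oo, Z w])); last first.
      apply/funext => v /=; rewrite indicE; congr ((nat_of_bool _)%:R%:E).
      by apply/idP/idP; rewrite inE/= in_itv.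
    rewrite integral_indic ?setIT//.
      rewrite [RHS]EFinM [RHS]muleC; congr (_ * _)%E.
      have mI : measurable (`]-oo, Z w]%classic : set R) by exact: measurable_itv.
      exact: etrans (U_unif mI) (uniform_cdf (Z01 w)).
    by rewrite -[X in measurable X]setTI; exact: mU.
  + apply/measurable_EFinP.
    exact: (bounded_mfun_indicator (measurable_fun_ler mU (measurable_cst _))).1.
- exact: measurable_fun_pair.
- move=> A B mA mB; apply: UG => //.
  have mZG := bZ.1; have mhG := bh.1.
  have := @measurable_fun_pair _ _ _ _ _ _ _ _ mZG mhG measurableT B mB.
  by rewrite setTI.
- by move=> v; rewrite /f lee_fin mulr_ge0.
Qed.

(** A bounded [h] is the difference of the nonnegative variables [h + |M|] and [|M|], to which
    [orth_norm] applies. *)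
Lemma uniform_threshold_orth (Z h : T -> R) : (forall w, 0 <= Z w <= 1) ->
  bounded_mfun (Z : g_sigma_algebraType G -> R) ->
  bounded_mfun (h : g_sigma_algebraType G -> R) ->
  \int[P]_w (h w * ((U w <= Z w)%R%:R - Z w)) = 0.
Proof.
move=> Z01 bZ bh; have [_ [M hM]] := bh.
have bZT := bounded_mfun_sub Gm bZ; have bhT := bounded_mfun_sub Gm bh.
have bUZ : bounded_mfun (fun w => (U w <= Z w)%R%:R : R).
  by apply: bounded_mfun_indicator; apply: measurable_fun_ler => //; exact: bZT.1.
pose g w := h w + `|M|.
have bg : bounded_mfun (g : g_sigma_algebraType G -> R).
  by apply: bounded_mfunD => //; exact: bounded_mfun_cst.
have bc : bounded_mfun ((fun=> `|M|) : g_sigma_algebraType G -> R).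
  exact: bounded_mfun_cst.
have gE w : `|g w| = h w + `|M|.
  rewrite ger0_norm// /g; have := hM w; have := ler_norm M.
  rewrite ler_norml => ? /andP[? _]; lra.
have H1 := orth_norm Z01 bZ bg; have H2 := orth_norm Z01 bZ bc.
have bgT := bounded_mfun_sub Gm bg; have bcT := bounded_mfun_sub Gm bc.
have I1 := bounded_mfun_integrable P (bounded_mfunM bUZ bgT).
have I2 := bounded_mfun_integrable P (bounded_mfunM bZT bgT).
have I3 := bounded_mfun_integrable P (bounded_mfunM bUZ bcT).
have I4 := bounded_mfun_integrable P (bounded_mfunM bZT bcT).
have I5 := bounded_mfun_integrable P (bounded_mfunB (bounded_mfunM bUZ bgT)
  (bounded_mfunM bZT bgT)).
have I6 := bounded_mfun_integrable P (bounded_mfunB (bounded_mfunM bUZ bcT)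
  (bounded_mfunM bZT bcT)).
transitivity (\int[P]_w (((U w <= Z w)%R%:R * g w - Z w * g w) -
    ((U w <= Z w)%R%:R * `|M| - Z w * `|M|))).
  by apply: eq_Rintegral => w _; rewrite /g; ring.
rewrite RintegralB// RintegralB// RintegralB//.
have e1 : \int[P]_w ((U w <= Z w)%R%:R * g w) = \int[P]_w (Z w * g w).
  transitivity (\int[P]_w ((U w <= Z w)%R%:R * `|g w|)).
    by apply: eq_Rintegral => w _; rewrite gE.
  by rewrite H1; apply: eq_Rintegral => w _; rewrite gE.
have e2 : \int[P]_w ((U w <= Z w)%R%:R * `|M|) = \int[P]_w (Z w * `|M|).
  by move: H2; rewrite normr_id.
by rewrite e1 e2 !subrr.
Qed.

End uniform_threshold.

Lemma fourth_root_bracket n : (0 < n)%N ->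
  exists j, (j.+1 ^ 4 <= n < j.+2 ^ 4)%N.
Proof.
elim: n => // n IH _; have [->|n0] := posnP n; first by exists 0%N.
have [j /andP[j1 j2]] := IH n0.
have [h|h] := ltnP n.+1 (j.+2 ^ 4)%N; first by exists j; rewrite h (leqW j1).
exists j.+1; rewrite h /=.
have -> : n.+1 = (j.+2 ^ 4)%N by apply/eqP; rewrite eqn_leq h andbT.
by rewrite ltn_exp2r.
Qed.

(** * Law of large numbers with a rate for bounded orthogonal variables *)

Section orthogonal_deviation.
Context {R : realType} {d : measure_display} {T : measurableType d}.
Variables (P : probability T R) (x : nat -> T -> R) (B : R).
Hypothesis mx : forall k, measurable_fun setT (x k).
Hypothesis xB : forall k w, `|x k w| <= B.
Hypothesis orth : forall i j, (i < j)%N -> \int[P]_w (x i w * x j w) = 0.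

Let S n w := \sum_(0 <= k < n) x k w.

Let bx k : bounded_mfun (x k). Proof. by split=> //; exists B. Qed.

Let bS n : bounded_mfun (S n). Proof. exact: bounded_mfun_sum. Qed.

Let S_orth n k : (n <= k)%N -> \int[P]_w (S n w * x k w) = 0.
Proof.
elim: n => [|n IH] nk.
  transitivity (\int[P]_(w in setT) (0 : R)).
    by apply: eq_Rintegral => w _; rewrite /S big_geq// mul0r.
  by rewrite Rintegral_cst// mul0r.
transitivity (\int[P]_w (S n w * x k w + x n w * x k w)).
  by apply: eq_Rintegral => w _; rewrite /S big_nat_recr//= mulrDl.
rewrite RintegralD//.
- by rewrite IH ?orth ?addr0// ltnW.
- exact: bounded_mfun_integrable (bounded_mfunM (bS n) (bx k)).
- exact: bounded_mfun_integrable (bounded_mfunM (bx n) (bx k)).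
Qed.

Let S_second_moment n : \int[P]_w (S n w ^+ 2) <= n%:R * B ^+ 2.
Proof.
have int1 r : \int[P]_w (r : R) = r.
  by rewrite Rintegral_cst//= probability_setT mulr1.
elim: n => [|n IH].
  rewrite mul0r -[leRHS](int1 0) le_eqVlt; apply/orP; left; apply/eqP.
  by apply: eq_Rintegral => w _; rewrite /S big_geq// expr0n.
have -> : \int[P]_w (S n.+1 w ^+ 2) = \int[P]_w ((S n w + x n w) ^+ 2).
  by apply: eq_Rintegral => w _; rewrite /S big_nat_recr.
rewrite (Rintegral_expand P (bS n) (bx n)) S_orth// mulr0 addr0.
rewrite -natr1 mulrDl mul1r lerD// -[leRHS]int1.
apply: le_Rintegral => //.
- exact: bounded_mfun_integrable (bounded_mfunX 2 (bx n)).
- exact: bounded_mfun_integrable (bounded_mfun_cst _).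
move=> w _; have -> : x n w ^+ 2 = `|x n w| ^+ 2 by rewrite real_normK ?num_real.
by rewrite lerXn2r ?nnegrE// (le_trans _ (xB n w)).
Qed.

(* Chebyshev is applied along the fourth powers; between two of them the sums vary
   by at most a constant times [j ^ 3]. *)
Let F j := [set w | j.+1%:R ^+ 3 <= `|S (j.+1 ^ 4)%N w|].

Let mF j : measurable (F j).
Proof.
rewrite -[X in measurable X]setTI; apply: measurable_fun_ler => //.
by apply: measurableT_comp => //; exact: (bS _).1.
Qed.

(** Chebyshev bounds the probability of [F j] by [B ^+ 2 / t ^+ 2] with [t = j + 1], and
    [1 / t ^+ 2] is at most [2 / t - 2 / (t + 1)]: the differences of [v] form a telescoping
    majorant for Borel-Cantelli. *)
Let v j : R := 2 * B ^+ 2 / j.+1%:R.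

Let PF j : (P (F j) <= (v j - v j.+1)%:E)%E.
Proof.
have j0 : (0 : R) < j.+1%:R by rewrite ltr0n.
apply: (le_trans (chebyshev_bounded P (exprn_gt0 3 j0) (bS _))).
rewrite lee_fin ler_pdivrMr ?exprn_gt0//.
apply: (le_trans (S_second_moment _)).
have e2 : (j.+2%:R : R) = j.+1%:R + 1 by rewrite natr1.
rewrite natrX /v e2; have h1 : (1 : R) <= j.+1%:R by rewrite ler1n.
move: (j.+1%:R : R) j0 h1 => t t0 t1.
have -> : (2 * B ^+ 2 / t - 2 * B ^+ 2 / (t + 1)) * (t ^+ 3) ^+ 2 =
  t ^+ 4 * B ^+ 2 * (2 * t / (t + 1)) by field; lra.
have tB : 0 <= t ^+ 4 * B ^+ 2.
  by apply: mulr_ge0; [exact: exprn_ge0 (ltW t0)|exact: sqr_ge0].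
rewrite ler_peMr// ler_pdivlMr; lra.
Qed.

Lemma orthogonal_deviation :
  {ae P, forall w, exists D, forall n, (S n w) ^+ 4 <= D * n%:R ^+ 3}.
Proof.
have v0 j : 0 <= v j.
  by apply: divr_ge0 => //; apply: mulr_ge0 => //; exact: sqr_ge0.
have PF_oo : (\sum_(j <oo) P (F j) < +oo)%E.
  apply: (@le_lt_trans _ _ (v 0%N)%:E); last by rewrite ltry.
  apply: lime_le; first by apply: is_cvg_nneseries.
  apply: nearW => n; apply: (@le_trans _ _ (\sum_(0 <= j < n) (v j - v j.+1)%:E)%E).
    by apply: lee_sum => j _.
  by rewrite sumEFin lee_fin telescope_sum_le.
exists (lim_sup_set F); split.
- by apply: bigcapT_measurable => n; apply: bigcup_measurable.
- exact: lim_sup_set_cvg0.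
move=> w /= noD J _; apply: contrapT => nF; apply: noD.
have B0 : 0 <= B by exact: le_trans (xB 0%N w).
have HJ j : (J <= j)%N -> `|S (j.+1 ^ 4)%N w| < j.+1%:R ^+ 3.
  by move=> Jj; rewrite ltNge; apply/negP => h; apply: nF; exists j.
have Sdiff m n : (m <= n)%N -> `|S n w| <= `|S m w| + B * (n - m)%:R.
  move=> mn; rewrite /S (big_cat_nat _ mn)//= (le_trans (ler_normD _ _))// lerD2l.
  rewrite (le_trans (ler_norm_sum _ _ _))// mulr_natr -sumr_const_nat.
  exact: ler_sum.
(* [K1] serves the ranks below [J.+1 ^ 4], through [|S n| <= B * n]; [K2] serves the others, through
   [|S n| <= (1 + 15 * B) * j.+1 ^ 3] and [j.+1 ^ 4 <= n]. *)
pose K1 := B ^+ 4 * (J.+1 ^ 4)%:R; pose K2 := (1 + 15 * B) ^+ 4.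
have K10 : 0 <= K1 by rewrite mulr_ge0// exprn_ge0.
have K20 : 0 <= K2 by rewrite exprn_ge0// addr_ge0// mulr_ge0.
exists (K1 + K2) => n.
rewrite -[X in X ^+ 4]/(S n w) -[leLHS]ger0_norm ?exprn_even_ge0// normrX.
have [nJ|Jn] := ltnP n (J.+1 ^ 4)%N.
  rewrite (@le_trans _ _ (K1 * n%:R ^+ 3))//; last first.
    by rewrite ler_wpM2r ?exprn_ge0// lerDl.
  have S0 : S 0%N w = 0 by rewrite /S big_geq.
  have := Sdiff 0%N n (leq0n _); rewrite S0 normr0 add0r subn0 => h.
  apply: (@le_trans _ _ ((B * n%:R) ^+ 4)).
    by rewrite lerXn2r ?nnegrE ?mulr_ge0.
  rewrite exprMn (exprS n%:R 3) mulrA ler_wpM2r ?exprn_ge0//.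
  by rewrite /K1 ler_wpM2l ?exprn_ge0// ler_nat (ltnW nJ).
have n0 : (0 < n)%N by rewrite (leq_trans _ Jn)// expn_gt0.
have [j /andP[j1 j2]] := fourth_root_bracket n0.
have Jj : (J <= j)%N.
  by rewrite -ltnS -ltnS -(@ltn_exp2r _ _ 4)// (leq_ltn_trans Jn).
rewrite (@le_trans _ _ (K2 * n%:R ^+ 3))//; last first.
  by rewrite ler_wpM2r ?exprn_ge0// lerDr.
have h := le_trans (Sdiff _ _ j1) (lerD (ltW (HJ j Jj)) (lexx _)).
have t1 : (1 : R) <= j.+1%:R by rewrite ler1n.
(* With [t = j.+1 >= 1], the gap [(t + 1) ^ 4 - t ^ 4 = 4 t ^ 3 + 6 t ^ 2 + 4 t + 1] is at most
   [15 t ^ 3]. *)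
have hn : ((n - j.+1 ^ 4)%:R : R) <= 15 * j.+1%:R ^+ 3.
  rewrite -natrX -natrM ler_nat; nia.
have jn : (j.+1%:R : R) ^+ 4 <= n%:R by rewrite -natrX ler_nat.
apply: (@le_trans _ _ (((1 + 15 * B) * j.+1%:R ^+ 3) ^+ 4)).
  rewrite lerXn2r ?nnegrE ?mulr_ge0 ?exprn_ge0 ?addr_ge0 ?mulr_ge0//.
  rewrite (le_trans h)// mulrDl mul1r lerD2l (mulrC 15) -mulrA ler_wpM2l//.
rewrite exprMn ler_wpM2l// -exprM (_ : (3 * 4 = 4 * 3)%N)// exprM.
by rewrite lerXn2r ?nnegrE ?exprn_ge0.
Qed.

End orthogonal_deviation.

(** * The urn process *)

Lemma bounded_mfunV {R : realType} {d} {T : measurableType d} (c0 : R) (c : T -> R) :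
  0 < c0 -> (forall w, c0 <= c w) -> measurable_fun setT c ->
  bounded_mfun (fun w => (c w)^-1).
Proof.
move=> c00 cc0 mc; have cp w : 0 < c w by exact: lt_le_trans (cc0 w).
split; last first.
  exists c0^-1 => w; rewrite ger0_norm ?invr_ge0 ?(ltW (cp w))//.
  by rewrite lef_pV2 ?posrE.
rewrite (_ : (fun w => _) = (fun w => expR (- ln (c w)))); last first.
  by apply/funext => w; rewrite -lnV ?posrE// lnK// posrE invr_gt0.
apply: measurableT_comp => //; apply: measurable_funN.
by apply: measurableT_comp => //; exact: measurable_ln.
Qed.

(** The lower bound applies [ln (1 + x) <= x] to the inverse [1 - t / (1 + t)], whence
    [ln (1 + t) >= t / (1 + t) >= t - t ^+ 2]. *)
Lemma ln1D_quadratic {R : realType} (t : R) : 0 <= t -> `|ln (1 + t) - t| <= t ^+ 2.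
Proof.
move=> t0; have t1 : 0 < 1 + t by lra.
have h1 : ln (1 + t) <= t by apply: le_ln1Dx; lra.
have h2 : - ln (1 + t) <= - (t / (1 + t)).
  have e : (1 + t)^-1 = 1 + - (t / (1 + t)) by field; rewrite gt_eqF.
  rewrite -lnV ?posrE// [X in ln X]e.
  apply: le_ln1Dx; rewrite ltrN2 ltr_pdivrMr//; lra.
have h3 : t - t ^+ 2 <= t / (1 + t).
  rewrite ler_pdivlMr// (_ : (t - t ^+ 2) * (1 + t) = t - t ^+ 3); last by ring.
  by rewrite gerBl exprn_ge0.
have := sqr_ge0 t; rewrite ler_norml => ?; apply/andP; split; lra.
Qed.

(** * The logarithmic law of one colour *)

Section colour.
Context {R : realType} {d : measure_display} {T : measurableType d}.
Variables (P : probability T R) (G : nat -> set (set T)).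
(** [c] counts one colour, [chi] indicates that it is drawn, [zeta] is its share and [wt] its
    threshold test. Both colours of the urn are instances. *)
Variables (c0 b : R) (c y D zeta chi : nat -> T -> R) (wt : nat -> T -> bool).
Hypothesis Gm : forall k, G k `<=` measurable.
Hypothesis GS : forall k, G k `<=` <<s G k.+1 >>.
Hypothesis c00 : 0 < c0.
Hypothesis cc0 : forall n w, c0 <= c n w.
Hypothesis bc : forall n, bounded_mfun (c n : g_sigma_algebraType (G n) -> R).
Hypothesis zetaE : forall n w, zeta n w = c n w / y n w.
Hypothesis bzeta : forall n, bounded_mfun (zeta n : g_sigma_algebraType (G n) -> R).
Hypothesis D0b : forall n w, 0 <= D n w <= b.
Hypothesis bD : forall n, bounded_mfun (D n : g_sigma_algebraType (G n) -> R).
Hypothesis mwt : forall n, measurable_fun setT (wt n : g_sigma_algebraType (G n) -> bool).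
Hypothesis chi01 : forall n w, chi n w = 0 \/ chi n w = 1.
Hypothesis bchi : forall n, bounded_mfun (chi n : g_sigma_algebraType (G n.+1) -> R).
Hypothesis orth : forall n h, bounded_mfun (h : g_sigma_algebraType (G n) -> R) ->
  \int[P]_w (h w * (chi n w - zeta n w)) = 0.
Hypothesis cS : forall n w,
  c n.+1 w = c n w + chi n w * (D n w * (wt n w)%:R).

Let g n w := D n w * (wt n w)%:R / c n w.

Let c_gt0 n w : 0 < c n w. Proof. exact: lt_le_trans (cc0 n w). Qed.

Let bg n : bounded_mfun (g n : g_sigma_algebraType (G n) -> R).
Proof.
apply: bounded_mfunM.
  by apply: bounded_mfunM => //; exact: bounded_mfun_indicator (@mwt n).
exact: (@bounded_mfunV _ _ (g_sigma_algebraType (G n)) _ _ c00 (cc0 n) (bc n).1).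
Qed.

Let toT n (f : T -> R) : bounded_mfun (f : g_sigma_algebraType (G n) -> R) -> bounded_mfun f.
Proof. exact: bounded_mfun_sub (@Gm n). Qed.

Let K := b * (1 + b / c0).

Let b_ge0 : 0 <= b.
Proof. by have /andP[] := D0b 0%N point; exact: le_trans. Qed.

(** When the colour is drawn and added, with [t = c n w] and reward [D'], the claim reduces to
    [D' * (t + D') <= K * t], true since [D' <= b] and [t >= c0]. *)
Let jump_telescope n w :
  g n w ^+ 2 * chi n w <= K * (c n w)^-1 - K * (c n.+1 w)^-1.
Proof.
rewrite cS /g; have /andP[D0 Db] := D0b n w; have := c_gt0 n w; have := cc0 n w.
case: (chi01 n w) => ->; first by rewrite mul0r addr0 subrr mulr0.
case: (wt n w); last first.
  by rewrite mulr0 mul0r expr0n mul0r mulr0 addr0 subrr.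
rewrite !mulr1 mul1r.
move: (c n w) (D n w) D0 Db b_ge0 => t D' D0 Db b0 ct t0.
have tD : 0 < t + D' by lra.
rewrite -subr_ge0 (_ : _ - _ =
  D' / (t ^+ 2 * (t + D')) * (K * t - D' * (t + D'))); last first.
  by field; rewrite !gt_eqF.
rewrite mulr_ge0 ?divr_ge0 ?mulr_ge0 ?exprn_ge0 ?(ltW t0) ?(ltW tD)// subr_ge0.
have h1 : D' * (t + D') <= b * (t + b) by apply: ler_pM => //; lra.
apply: (le_trans h1); rewrite /K -mulrA ler_wpM2l// mulrDl mul1r lerD2l.
rewrite -mulrA ler_peMr// mulrC ler_pdivlMr ?mul1r//.
Qed.

(** Since [zeta * g] is the compensating term, the sequence is [ln (c 0)] plus a martingale with
    increments [g * (chi - zeta)] plus the errors [ln (1 + g * chi) - g * chi]. The variances of the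
    former and the absolute values of the latter are dominated by the telescoping differences of
    [K / c], in mean and pathwise respectively. *)
Lemma colour_ln_cvg : {ae P, forall w,
  cvgn (fun n => ln (c n w) - \sum_(0 <= k < n) D k w * (wt k w)%:R / y k w)}.
Proof.
pose x n w := g n w * (chi n w - zeta n w).
have bx n : bounded_mfun (x n : g_sigma_algebraType (G n.+1) -> R).
  apply: bounded_mfunM; first exact: bounded_mfun_mono (@GS _) (bg n).
  by apply: bounded_mfunB => //; exact: bounded_mfun_mono (@GS _) (bzeta n).
have Kv0 n w : 0 <= K * (c n w)^-1.
  rewrite mulr_ge0 ?invr_ge0 ?(ltW (c_gt0 n w))// mulr_ge0//.
  by rewrite addr_ge0// divr_ge0 ?b_ge0// ltW.
have bcV n : bounded_mfun (fun w => K * (c n w)^-1).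
  apply: bounded_mfunM; first exact: bounded_mfun_cst.
  exact: bounded_mfunV c00 (cc0 n) (toT (bc n)).1.
pose v n := \int[P]_w (K * (c n w)^-1).
have xv n : \int[P]_w (x n w ^+ 2) <= v n - v n.+1.
  have bg2 := bounded_mfunX 2 (bg n).
  have bz := bzeta n.
  have bh2 : bounded_mfun ((fun w => g n w ^+ 2 * (- 2 * zeta n w)) :
      g_sigma_algebraType (G n) -> R).
    by apply: bounded_mfunM => //; apply: bounded_mfunM => //; exact: bounded_mfun_cst.
  have bchiT := toT (bchi n).
  have bchz := bounded_mfunB bchiT (toT bz).
  have I1 := bounded_mfun_integrable P (bounded_mfunM (toT bh2) bchz).
  have I2 := bounded_mfun_integrable P (bounded_mfunB (bcV n) (bcV n.+1)).
  (* [(chi - zeta) ^ 2 <= chi - 2 zeta (chi - zeta)] as [chi ^ 2 = chi], and the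
     last term is orthogonal to the past. *)
  have -> : v n - v n.+1 =
     \int[P]_w (g n w ^+ 2 * (- 2 * zeta n w) * (chi n w - zeta n w)
     + (K * (c n w)^-1 - K * (c n.+1 w)^-1)).
    rewrite RintegralD// orth// add0r RintegralB//; exact: bounded_mfun_integrable.
  apply: le_Rintegral => //.
  - exact: bounded_mfun_integrable (bounded_mfunX 2 (toT (bx n))).
  - exact: bounded_mfun_integrable (bounded_mfunD (bounded_mfunM (toT bh2) bchz)
      (bounded_mfunB (bcV n) (bcV n.+1))).
  move=> w _; have := jump_telescope n w.
  have -> : x n w ^+ 2 = g n w ^+ 2 * (chi n w - zeta n w) ^+ 2 by rewrite exprMn.
  have : g n w ^+ 2 * (chi n w - zeta n w) ^+ 2 <=
      g n w ^+ 2 * (- 2 * zeta n w) * (chi n w - zeta n w) + g n w ^+ 2 * chi n w.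
    rewrite -mulrA -mulrDr ler_wpM2l ?sqr_ge0//.
    by have := sqr_ge0 (zeta n w); case: (chi01 n w) => ->; nra.
  lra.
have orthx n h : bounded_mfun (h : g_sigma_algebraType (G n) -> R) ->
    \int[P]_w (h w * x n w) = 0.
  move=> bh; rewrite -[RHS](orth (bounded_mfunM bh (bg n))).
  by apply: eq_Rintegral => w _; rewrite mulrA.
have bdd : exists C, forall n, \sum_(0 <= k < n) \int[P]_w (x k w ^+ 2) <= C.
  exists (v 0%N) => n; apply: (@le_trans _ _ (\sum_(0 <= k < n) (v k - v k.+1))).
    exact: ler_sum.
  by apply: telescope_sum_le => k; apply: Rintegral_ge0.
apply: filterS (l2_martingale_cvg Gm GS bx orthx bdd) => w cx.
pose e n := ln (c n.+1 w) - ln (c n w) - g n w * chi n w.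
have ce : cvgn (fun n => \sum_(0 <= k < n) e k).
  apply: (@is_cvg_series_telescope _ _ (fun n => K * (c n w)^-1)) => // n.
  apply: le_trans (jump_telescope n w).
  have -> : g n w ^+ 2 * chi n w = (g n w * chi n w) ^+ 2.
    rewrite [RHS]exprMn; congr (_ * _).
    by case: (chi01 n w) => ->; rewrite ?expr1n// expr0n.
  have cSE : c n.+1 w = c n w * (1 + g n w * chi n w).
    by rewrite cS /g; field; rewrite gt_eqF.
  have g0 : 0 <= g n w * chi n w.
    have /andP[D0 _] := D0b n w.
    rewrite mulr_ge0 ?divr_ge0 ?mulr_ge0 ?(ltW (c_gt0 n w))//.
    by case: (chi01 n w) => ->.
  have g1 : 0 < 1 + g n w * chi n w by rewrite ltr_wpDr.
  have -> : e n = ln (1 + g n w * chi n w) - g n w * chi n w.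
    by rewrite /e cSE lnM ?posrE//; ring.
  exact: ln1D_quadratic.
rewrite (_ : (fun n => _) = (fun n => ln (c 0%N w) + \sum_(0 <= k < n) x k w +
    \sum_(0 <= k < n) e k)); last first.
  apply/funext; elim=> [|n IH]; first by rewrite !big_geq// subr0 !addr0.
  rewrite !big_nat_recr//=.
  have -> : D n w * (wt n w)%:R / y n w = zeta n w * g n w.
    rewrite zetaE /g; move: (y n w)^-1 => yV; field; rewrite gt_eqF//.
  rewrite /x /e; move: IH; lra.
apply: is_cvgD => //; apply: is_cvgD => //; exact: is_cvg_cst.
Qed.

End colour.

(** * Deviations of the sums of rewards *)

Section iid_rewards.
Context {R : realType} {d dS} {T : measurableType d} {S : measurableType dS}.
Variables (P : probability T R) (mu : probability S R) (a b : R) (u : S -> R).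
Variable xi : nat -> T -> S.
Hypothesis a0 : 0 < a.
Hypothesis mes_u : measurable_fun setT u.
Hypothesis u_ab : forall s, a <= u s <= b.
Hypothesis mxi : forall n, measurable_fun setT (xi n).
Hypothesis lxi : forall n B, measurable B -> P (xi n @^-1` B) = mu B.
Hypothesis ixi : forall i j A B, (i < j)%N -> measurable A -> measurable B ->
  P (xi i @^-1` A `&` xi j @^-1` B) = (P (xi i @^-1` A) * P (xi j @^-1` B))%E.

Let m := \int[P]_w u (xi 0%N w).

Let u0 s : 0 <= u s.
Proof. by have /andP[+ _] := u_ab s; apply: le_trans; exact: ltW. Qed.

Let bD n : bounded_mfun (fun w => u (xi n w)).
Proof.
split; first exact: measurableT_comp.
by exists b => w; rewrite ger0_norm//; have /andP[] := u_ab (xi n w).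
Qed.

Let mean n : (\int[P]_w (u (xi n w))%:E = m%:E)%E.
Proof.
have law k : (\int[P]_w (u (xi k w))%:E = \int[mu]_s (u s)%:E)%E.
  pose xik : {mfun T >-> S} := HB.pack (xi k) (isMeasurableFun.Build _ _ _ _ _ (mxi k)).
  have := @ge0_integral_distribution _ _ _ _ _ P xik (EFin \o u).
  rewrite /comp/= => <-; last 2 first.
  - exact/measurable_EFinP.
  - by move=> s; rewrite lee_fin.
  by apply: eq_measure_integral => A mA _; exact: lxi.
have := integrable_fin_num measurableT (bounded_mfun_integrable P (bD 0)).
by rewrite law -(law 0%N) => /fineK <-.
Qed.

(** Pairwise independence and equal means make the centred rewards orthogonal, and they are bounded
    by [b + |m|]. *)
Lemma iid_reward_deviation : {ae P, forall w, exists D, forall n,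
  (\sum_(0 <= k < n) (u (xi k w) - m)) ^+ 4 <= D * n%:R ^+ 3}.
Proof.
have b0 : 0 <= b by have /andP[_] := u_ab point; exact: le_trans.
apply: (@orthogonal_deviation _ _ _ P (fun k w => u (xi k w) - m) (b + `|m|)).
- by move=> k; apply: measurable_funB => //; exact: (bD k).1.
- move=> k w; rewrite (le_trans (ler_normB _ _))// lerD2r ger0_norm//.
  by have /andP[] := u_ab (xi k w).
move=> i j ij.
have bm : bounded_mfun (fun _ : T => m) by exact: bounded_mfun_cst.
have Rmean k : \int[P]_w (u (xi k w)) = m by rewrite /Rintegral mean.
have prod : \int[P]_w (u (xi i w) * u (xi j w)) = m * m.
  rewrite /Rintegral.
  rewrite (@ge0_integral_indep _ _ _ _ _ _ _ P (xi i) (xi j)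
    (fun s => (u s.1 * u s.2)%:E))//=.
  - transitivity (fine (\int[P]_w (m * u (xi j w))%:E)).
      congr fine; apply: eq_integral => w _.
      under eq_integral do rewrite mulrC EFinM.
      rewrite ge0_integralZl//= ?mean ?lee_fin//.
      + by rewrite -EFinM mulrC.
      + by apply/measurable_EFinP; exact: (bD i).1.
      + by move=> v _; rewrite lee_fin.
    have := @RintegralZl _ _ _ P setT (fun w => u (xi j w)) m measurableT.
    rewrite Rmean; apply; exact: bounded_mfun_integrable.
  - by move=> A B mA mB; exact: ixi.
  - apply/measurable_EFinP; apply: measurable_funM; exact: measurableT_comp.
  - by move=> s; rewrite lee_fin mulr_ge0.
transitivity (\int[P]_w ((u (xi i w) * u (xi j w) - m * u (xi i w)) -
    (m * u (xi j w) - m * m))).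
  by apply: eq_Rintegral => w _; ring.
have I1 := bounded_mfun_integrable P (bounded_mfunM (bD i) (bD j)).
have I2 := bounded_mfun_integrable P (bounded_mfunM bm (bD i)).
have I3 := bounded_mfun_integrable P (bounded_mfunM bm (bD j)).
have I4 := bounded_mfun_integrable P (bounded_mfunM bm bm).
have I5 := bounded_mfun_integrable P
  (bounded_mfunB (bounded_mfunM (bD i) (bD j)) (bounded_mfunM bm (bD i))).
have I6 := bounded_mfun_integrable P
  (bounded_mfunB (bounded_mfunM bm (bD j)) (bounded_mfunM bm bm)).
have Id k := bounded_mfun_integrable P (bD k).
rewrite RintegralB// RintegralB// RintegralB// prod RintegralZl//.
rewrite (@RintegralZl _ _ _ P setT (fun w => u (xi j w)))// !Rmean.
by rewrite Rintegral_cst//= probability_setT mulr1 !subrr.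
Qed.

End iid_rewards.

Lemma ae_probability1 {R : realType} {d} {T : measurableType d}
    (P : probability T R) (A : set T) :
  measurable A -> {ae P, forall w, A w} -> P A = 1%E.
Proof.
move=> mA aeA.
have nA : P (~` A) = 0%E by apply: measure_negligible => //; exact: measurableC.
have := probability_setC P mA; rewrite nA => /esym/eqP.
by rewrite sube_eq// add0e => /eqP.
Qed.

Section generated_measurability.
Context {d d'} {T : measurableType d} {T' : measurableType d'}.
Variables (G : set (set T)) (f : T -> T').

Lemma measurable_fun_generated :
  (forall B, measurable B -> <<s G >> (f @^-1` B)) ->
  measurable_fun setT (f : g_sigma_algebraType G -> T').
Proof. by move=> Gf _ B mB; rewrite setTI; exact: Gf. Qed.

Lemma pre_class_measurable : measurable_fun setT f -> pre_class f `<=` measurable.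
Proof. by move=> mf _ [B mB <-]; rewrite -[X in measurable X]setTI; exact: mf. Qed.

End generated_measurability.

(** * The urn as a process adapted to the filtration enlarged by all rewards *)

Section urn_process.
Context {R : realType} {dO dS dF : measure_display} {Om : measurableType dO}
  {S : measurableType dS} {Phi : measurableType dF}.
Variables (P : probability Om R) (a b : R) (u : S -> R).
Variables (xi1 xi2 : nat -> Om -> S) (U : nat -> Om -> R) (phi : nat -> Om -> Phi).
Variables (y10 y20 : R) (rh1 rh2 X Y1 Y2 : nat -> Om -> R).
Hypothesis a0 : 0 < a.
Hypothesis mes_u : measurable_fun setT u.
Hypothesis u_ab : forall s, a <= u s <= b.
Hypothesis mxi1 : forall n, measurable_fun setT (xi1 n).
Hypothesis mxi2 : forall n, measurable_fun setT (xi2 n).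
Hypothesis mU : forall n, measurable_fun setT (U n).
Hypothesis mphi : forall n, measurable_fun setT (phi n).
Hypothesis U_unif : forall n B, measurable B ->
  P (U n.+1 @^-1` B) = lebesgue_measure (B `&` `]0, 1[).
Hypothesis y10_gt0 : 0 < y10.
Hypothesis y20_gt0 : 0 < y20.
Hypothesis Y10 : Y1 0%N = (fun=> y10).
Hypothesis Y20 : Y2 0%N = (fun=> y20).

Let Z n w := Y1 n w / (Y1 n w + Y2 n w).
Let F n := gen_sigma (\bigcup_(i in [set i : nat | (0 < i <= n)%N])
                (pre_class (X i) `|`
                 pre_class (fun w => if X i w == 1 then xi1 i w else xi2 i w) `|`
                 pre_class (phi i))).
Let G n := F n `|` gen_family (fun k : nat => pre_class (xi1 k.+1))
              `|` gen_family (fun k : nat => pre_class (xi2 k.+1)).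

Hypothesis UG : forall n, indep2 P (pre_class (U n.+1)) (gen_sigma (G n)).
Hypothesis rh01 : forall n w, 0 <= rh2 n w /\ rh2 n w <= rh1 n w /\ rh1 n w <= 1.
Hypothesis Frh1 : forall n B, measurable B -> F n (rh1 n @^-1` B).
Hypothesis Frh2 : forall n B, measurable B -> F n (rh2 n @^-1` B).
Hypothesis XE : forall n w, X n.+1 w = if U n.+1 w <= Z n w then 1 else 0.
Hypothesis Y1E : forall n w, Y1 n.+1 w = Y1 n w + X n.+1 w * u (xi1 n.+1 w) *
                           (if Z n w <= rh1 n w then 1 else 0).
Hypothesis Y2E : forall n w, Y2 n.+1 w = Y2 n w + (1 - X n.+1 w) * u (xi2 n.+1 w) *
                           (if Z n w >= rh2 n w then 1 else 0).

Let X01 n w : X n.+1 w = 0 \/ X n.+1 w = 1.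
Proof. by rewrite XE; case: ifP; [right|left]. Qed.

Let u_ge0 s : 0 <= u s.
Proof. by have /andP[+ _] := u_ab s; apply: le_trans; exact: ltW. Qed.

Let Y1_ge n w : y10 <= Y1 n w.
Proof.
elim: n => [|n IH]; first by rewrite Y10.
rewrite Y1E (le_trans IH)// lerDl.
by case: (X01 n w) => ->; case: ifP; rewrite ?mul0r ?mul1r ?mulr1 ?mulr0.
Qed.

Let Y2_ge n w : y20 <= Y2 n w.
Proof.
elim: n => [|n IH]; first by rewrite Y20.
rewrite Y2E (le_trans IH)// lerDl.
by case: (X01 n w) => ->; case: ifP; rewrite ?subrr ?subr0 ?mul0r ?mul1r ?mulr1 ?mulr0.
Qed.

Let Y1_gt0 n w : 0 < Y1 n w. Proof. exact: lt_le_trans (Y1_ge n w). Qed.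
Let Y2_gt0 n w : 0 < Y2 n w. Proof. exact: lt_le_trans (Y2_ge n w). Qed.

Let Z01 n w : 0 <= Z n w <= 1.
Proof.
rewrite /Z divr_ge0 ?addr_ge0 ?(ltW (Y1_gt0 _ _)) ?(ltW (Y2_gt0 _ _))//=.
by rewrite ler_pdivrMr ?addr_gt0// mul1r lerDl ltW.
Qed.

Let FG n : F n `<=` <<s G n >>.
Proof. by move=> A FA; apply: sub_sigma_algebra; left; left. Qed.

Let F_pre n i : (0 < i <= n)%N -> pre_class (X i) `<=` F n.
Proof.
by move=> i0n A XA; apply: sub_sigma_algebra; exists i => //; left; left.
Qed.

Let FS n : F n `<=` F n.+1.
Proof.
apply: sub_sigma_algebra2 => A [i /= /andP[i0 ni] XA]; exists i => //=.
by rewrite i0 leqW.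
Qed.

Let GS n : G n `<=` <<s G n.+1 >>.
Proof.
move=> A [[/FS/FG//|xA]|xA]; apply: sub_sigma_algebra; first by left; right.
by right.
Qed.

Let xi1_G n k B : measurable B -> <<s G n >> (xi1 k.+1 @^-1` B).
Proof.
move=> mB; apply: sub_sigma_algebra; left; right.
by apply: sub_sigma_algebra; exists k => //; exists B.
Qed.

Let xi2_G n k B : measurable B -> <<s G n >> (xi2 k.+1 @^-1` B).
Proof.
move=> mB; apply: sub_sigma_algebra; right.
by apply: sub_sigma_algebra; exists k => //; exists B.
Qed.

Let bu (xi : Om -> S) n : (forall B, measurable B -> <<s G n >> (xi @^-1` B)) ->
  bounded_mfun ((fun w => u (xi w)) : g_sigma_algebraType (G n) -> R).
Proof.
move=> Gxi; split.
  by apply: measurableT_comp => //; exact: measurable_fun_generated.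
by exists b => w; rewrite ger0_norm//; have /andP[] := u_ab (xi w).
Qed.

Let bX n i : (i < n)%N ->
  bounded_mfun (X i.+1 : g_sigma_algebraType (G n) -> R).
Proof.
move=> i_n; split.
  apply: measurable_fun_generated => B mB; apply: FG.
  by apply: (F_pre (i := i.+1)) => //; exists B.
by exists 1 => w; case: (X01 i w) => ->; rewrite ?normr0 ?normr1.
Qed.

Let brh1 n : bounded_mfun (rh1 n : g_sigma_algebraType (G n) -> R).
Proof.
split; first by apply: measurable_fun_generated => B mB; apply: FG; exact: Frh1.
exists 1 => w; have [? [? ?]] := rh01 n w.
by rewrite ger0_norm//; lra.
Qed.

Let brh2 n : bounded_mfun (rh2 n : g_sigma_algebraType (G n) -> R).
Proof.
split; first by apply: measurable_fun_generated => B mB; apply: FG; exact: Frh2.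
exists 1 => w; have [? [? ?]] := rh01 n w.
by rewrite ger0_norm//; lra.
Qed.

(** Conditional on the counts at rank [n], because it serves inside the induction that establishes
    [bY]. *)
Let bZ_of n : bounded_mfun (Y1 n : g_sigma_algebraType (G n) -> R) ->
  bounded_mfun (Y2 n : g_sigma_algebraType (G n) -> R) ->
  bounded_mfun (Z n : g_sigma_algebraType (G n) -> R).
Proof.
move=> b1 b2; apply: bounded_mfunM => //.
apply: (@bounded_mfunV _ _ (g_sigma_algebraType (G n)) (y10 + y20)).
- by rewrite addr_gt0.
- by move=> w; apply: lerD.
- exact: (bounded_mfunD b1 b2).1.
Qed.

Let mw1_of n : bounded_mfun (Z n : g_sigma_algebraType (G n) -> R) ->
  measurable_fun setT ((fun w => Z n w <= rh1 n w) : g_sigma_algebraType (G n) -> bool).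
Proof. by move=> bZ; apply: measurable_fun_ler; [exact: bZ.1|exact: (brh1 n).1]. Qed.

Let mw2_of n : bounded_mfun (Z n : g_sigma_algebraType (G n) -> R) ->
  measurable_fun setT ((fun w => rh2 n w <= Z n w) : g_sigma_algebraType (G n) -> bool).
Proof. by move=> bZ; apply: measurable_fun_ler; [exact: (brh2 n).1|exact: bZ.1]. Qed.

Let ifE (c : bool) : (if c then 1 else 0) = c%:R :> R. Proof. by case: c. Qed.

Let bY n : bounded_mfun (Y1 n : g_sigma_algebraType (G n) -> R) /\
  bounded_mfun (Y2 n : g_sigma_algebraType (G n) -> R).
Proof.
elim: n => [|n [b1 b2]].
  by rewrite Y10 Y20; split; exact: bounded_mfun_cst.
have bZ := bZ_of b1 b2.
have lift f := @bounded_mfun_mono _ _ _ _ _ f (@GS n).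
have bX1 := bX (ltnSn n).
split.
- rewrite (_ : Y1 n.+1 = fun w => Y1 n w +
      X n.+1 w * u (xi1 n.+1 w) * (Z n w <= rh1 n w)%R%:R); last first.
    by apply/funext => w; rewrite Y1E ifE.
  apply: bounded_mfunD; first exact: lift.
  apply: bounded_mfunM.
    by apply: bounded_mfunM => //; apply: bu => B; exact: xi1_G.
  by apply: lift; apply: bounded_mfun_indicator; exact: mw1_of.
- rewrite (_ : Y2 n.+1 = fun w => Y2 n w +
      (1 - X n.+1 w) * u (xi2 n.+1 w) * (rh2 n w <= Z n w)%R%:R); last first.
    by apply/funext => w; rewrite Y2E ifE.
  apply: bounded_mfunD; first exact: lift.
  apply: bounded_mfunM.
    apply: bounded_mfunM; last by apply: bu => B; exact: xi2_G.
    by apply: bounded_mfunB => //; exact: bounded_mfun_cst.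
  by apply: lift; apply: bounded_mfun_indicator; exact: mw2_of.
Qed.

Let bZ n : bounded_mfun (Z n : g_sigma_algebraType (G n) -> R).
Proof. by have [b1 b2] := bY n; exact: bZ_of. Qed.

(** Strong induction: [F n] involves [X i.+1] for [i < n], which compares [U i.+1] with [Z i], and
    [Z i] is measurable once [G i] consists of measurable sets. *)
Let Gm n : G n `<=` measurable.
Proof.
have fam (xi : nat -> Om -> S) : (forall n, measurable_fun setT (xi n)) ->
    gen_family (fun k : nat => pre_class (xi k.+1)) `<=` measurable.
  move=> mxi; apply: smallest_sub; first exact: sigma_algebra_measurable.
  by apply: bigcup_sub => k _; exact: pre_class_measurable.
elim/ltn_ind: n => n IH.
rewrite !subUset; split; [split|]; [|exact: fam|exact: fam].
suff mX i : (i < n)%N -> measurable_fun setT (X i.+1).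
  apply: smallest_sub; first exact: sigma_algebra_measurable.
  apply: bigcup_sub => -[//|i] /= i_n; rewrite !subUset.
  split; [split|]; apply: pre_class_measurable => //; first exact: mX.
  apply: measurable_fun_ifT => //; apply: measurable_fun_eqr => //; exact: mX.
move=> i_n; rewrite (_ : X i.+1 = fun w => if U i.+1 w <= Z i w then 1 else 0).
  apply: measurable_fun_ifT => //; apply: measurable_fun_ler => //.
  exact: (bounded_mfun_sub (IH i i_n) (bZ i)).1.
by apply/funext => w; rewrite XE.
Qed.

Lemma share_measurable n : measurable_fun setT (Z n).
Proof. exact: (bounded_mfun_sub (@Gm n) (bZ n)).1. Qed.

Lemma share_bounds n w : 0 <= Z n w <= 1. Proof. exact: Z01. Qed.

Let orth n h : bounded_mfun (h : g_sigma_algebraType (G n) -> R) ->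
  \int[P]_w (h w * (X n.+1 w - Z n w)) = 0.
Proof.
move=> bh.
have UGn A B : measurable A -> <<s G n >> B ->
    P (U n.+1 @^-1` A `&` B) = (P (U n.+1 @^-1` A) * P B)%E.
  by move=> mA GB; apply: (@UG n) => //; exists A.
rewrite -[RHS](uniform_threshold_orth (@mU n.+1) (@Gm n) (@U_unif n) UGn
  (Z01 n) (bZ n) bh).
by apply: eq_Rintegral => w _; rewrite XE ifE.
Qed.

Let u_0b s : 0 <= u s <= b.
Proof. by rewrite u_ge0; have /andP[] := u_ab s. Qed.

Lemma ln_red_cvg : {ae P, forall w, cvgn (fun n => ln (Y1 n w) -
  \sum_(0 <= k < n) u (xi1 k.+1 w) * (Z k w <= rh1 k w)%R%:R / (Y1 k w + Y2 k w))}.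
Proof.
apply: (@colour_ln_cvg _ _ _ P G y10 b Y1 (fun n w => Y1 n w + Y2 n w)
  (fun n w => u (xi1 n.+1 w)) Z (fun n => X n.+1) (fun n w => Z n w <= rh1 n w)) => //.
- by move=> n; have [] := bY n.
- by move=> n; apply: bu => B; exact: xi1_G.
- by move=> n; exact: mw1_of.
- by move=> n; exact: bX.
- by move=> n w; rewrite Y1E ifE mulrA.
Qed.

Lemma ln_white_cvg : {ae P, forall w, cvgn (fun n => ln (Y2 n w) -
  \sum_(0 <= k < n) u (xi2 k.+1 w) * (rh2 k w <= Z k w)%R%:R / (Y1 k w + Y2 k w))}.
Proof.
have b1 n : bounded_mfun ((fun=> 1) : g_sigma_algebraType (G n) -> R).
  exact: bounded_mfun_cst.
apply: (@colour_ln_cvg _ _ _ P G y20 b Y2 (fun n w => Y1 n w + Y2 n w)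
  (fun n w => u (xi2 n.+1 w)) (fun n w => 1 - Z n w) (fun n w => 1 - X n.+1 w)
  (fun n w => rh2 n w <= Z n w)) => //.
- by move=> n; have [] := bY n.
- by move=> n w; rewrite /Z; field; rewrite gt_eqF// addr_gt0.
- by move=> n; apply: bounded_mfunB.
- by move=> n; apply: bu => B; exact: xi2_G.
- by move=> n; exact: mw2_of.
- by move=> n w; case: (X01 n w) => ->; rewrite ?subrr ?subr0; [right|left].
- by move=> n; apply: bounded_mfunB => //; exact: bX.
- move=> n h bh.
  (* [(1 - X) - (1 - Z)] is the opposite of [X - Z], so the red orthogonality is used with [- h]. *)
  have bNh : bounded_mfun ((fun w => -1 * h w) : g_sigma_algebraType (G n) -> R).
    by apply: bounded_mfunM => //; exact: bounded_mfun_cst.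
  rewrite -[RHS](orth bNh); apply: eq_Rintegral => w _; ring.
- by move=> n w; rewrite Y2E ifE mulrA.
Qed.

Variables (rho1 rho2 : R).
Hypothesis crh1 : as_cvg P rh1 (fun=> rho1).
Hypothesis crh2 : as_cvg P rh2 (fun=> rho2).
Let m1 := \int[P]_w u (xi1 1%N w).
Let m2 := \int[P]_w u (xi2 1%N w).
Hypothesis dev1 : {ae P, forall w, exists D, forall n,
  (\sum_(0 <= k < n) (u (xi1 k.+1 w) - m1)) ^+ 4 <= D * n%:R ^+ 3}.
Hypothesis dev2 : {ae P, forall w, exists D, forall n,
  (\sum_(0 <= k < n) (u (xi2 k.+1 w) - m2)) ^+ 4 <= D * n%:R ^+ 3}.

(** The two logarithmic laws, the two reward deviations and the two threshold limits hold together
    almost surely; the other requirements hold on every path. The reward at rank [n] of the path is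
    that of trial [n.+1]. *)
Lemma ae_urn_path : {ae P, forall w, urn_path a b m1 m2 rho1 rho2
  (fun n => Y1 n w + Y2 n w) (Y1 ^~ w) (Y2 ^~ w)
  (fun n => u (xi1 n.+1 w)) (fun n => u (xi2 n.+1 w)) (rh1 ^~ w) (rh2 ^~ w)
  (fun n => Z n w <= rh1 n w) (fun n => rh2 n w <= Z n w)}.
Proof.
apply: filterS (filterI (filterI ln_red_cvg ln_white_cvg)
  (filterI (filterI dev1 dev2) (filterI crh1 crh2))) => w.
move=> [[c1 c2] [[d1 d2] [r1 r2]]].
have b0 : 0 <= b by have /andP[] := u_0b point; exact: le_trans.
have bw (r : R) (t : bool) : 0 <= r <= b -> 0 <= r * t%:R <= b * t%:R.
  by case: t => /andP[r0 rb]; rewrite ?mulr1 ?mulr0 ?lexx ?r0 ?rb.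
split=> //; last by move=> n; have [_ []] := rh01 n w.
- split=> // n; rewrite Y1E ifE lerDl lerD2l -mulrA.
  case: (X01 n w) => ->; last by rewrite mul1r; exact: bw.
  by rewrite mul0r lexx mulr_ge0.
- split=> // n; rewrite Y2E ifE lerDl lerD2l -mulrA.
  case: (X01 n w) => ->; first by rewrite subr0 mul1r; exact: bw.
  by rewrite subrr mul0r lexx mulr_ge0.
Qed.

End urn_process.

(** * Almost sure limits of the share in the three cases *)

Unset Implicit Arguments.
Set Strict Implicit.
Set Printing Implicit Defensive.

Theorem theorem2p2
  (R : realType)
  (dO : measure_display) (Om : measurableType dO) (P : probability Om R)
  (dS : measure_display) (S : measurableType dS)
  (dF : measure_display) (Phi : measurableType dF)
  (a b : R) (u : S -> R)
  (mu1 mu2 : probability S R)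
  (xi1 xi2 : nat -> Om -> S)        (* xi_{j,n}, used for n >= 1 *)
  (U : nat -> Om -> R)              (* U_n, used for n >= 1 *)
  (phi : nat -> Om -> Phi)          (* auxiliary phi_n, used for n >= 1 *)
  (y10 y20 : R)
  (rh1 rh2 : nat -> Om -> R)        (* thresholds hat rho_{1,n}, hat rho_{2,n} *)
  (X Y1 Y2 : nat -> Om -> R)
  (rho1 rho2 : R) :
  (* u : S -> [a,b] measurable, 0 < a <= b *)
  0 < a -> a <= b -> measurable_fun setT u -> (forall s, a <= u s <= b) ->
  (* measurability of the basic random variables *)
  (forall n, measurable_fun setT (xi1 n)) ->
  (forall n, measurable_fun setT (xi2 n)) ->
  (forall n, measurable_fun setT (U n)) ->
  (forall n, measurable_fun setT (phi n)) ->
  (* xi_{1,n} ~ mu1, xi_{2,n} ~ mu2 *)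
  (forall n B, measurable B -> P (xi1 n.+1 @^-1` B) = mu1 B) ->
  (forall n B, measurable B -> P (xi2 n.+1 @^-1` B) = mu2 B) ->
  (* the xi_{1,n}, xi_{2,n} (n >= 1) are all mutually independent *)
  mutually_indep P (fun i : bool * nat =>
     pre_class (if i.1 then xi1 i.2.+1 else xi2 i.2.+1)) ->
  (* U_n uniform on (0,1) *)
  (forall n B, measurable B ->
     P (U n.+1 @^-1` B) = lebesgue_measure (B `&` `]0, 1[)) ->
  (* the U_n (n >= 1) are mutually independent *)
  mutually_indep P (fun n : nat => pre_class (U n.+1)) ->
  (* {U_n} independent of the xi's and of the phi's *)
  indep2 P (gen_family (fun n : nat => pre_class (U n.+1)))
           (gen_sigma (gen_family (fun n : nat => pre_class (xi1 n.+1)) `|`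
                       gen_family (fun n : nat => pre_class (xi2 n.+1)) `|`
                       gen_family (fun n : nat => pre_class (phi n.+1)))) ->
  (* initial composition *)
  0 < y10 -> 0 < y20 ->
  Y1 0%N = (fun => y10) -> Y2 0%N = (fun => y20) ->
  let Z n w := Y1 n w / (Y1 n w + Y2 n w) in
  (* F_n = sigma(X_i, X_i xi_{1,i} + (1 - X_i) xi_{2,i}, phi_i : 1 <= i <= n) *)
  let F n := gen_sigma (\bigcup_(i in [set i : nat | (0 < i <= n)%N])
                (pre_class (X i) `|`
                 pre_class (fun w => if X i w == 1 then xi1 i w else xi2 i w) `|`
                 pre_class (phi i))) in
  (* U_{n+1} independent of F_n and of the xi's *)
  (forall n, indep2 P (pre_class (U n.+1))
     (gen_sigma (F n `|` gen_family (fun k : nat => pre_class (xi1 k.+1))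
                     `|` gen_family (fun k : nat => pre_class (xi2 k.+1))))) ->
  (* thresholds: [0,1]-valued, ordered, F_n-measurable *)
  (forall n w, 0 <= rh2 n w /\ rh2 n w <= rh1 n w /\ rh1 n w <= 1) ->
  (forall n B, measurable B -> F n (rh1 n @^-1` B)) ->
  (forall n B, measurable B -> F n (rh2 n @^-1` B)) ->
  (* dynamics of the urn *)
  (forall n w, X n.+1 w = if U n.+1 w <= Z n w then 1 else 0) ->
  (forall n w, Y1 n.+1 w = Y1 n w + X n.+1 w * u (xi1 n.+1 w) *
                           (if Z n w <= rh1 n w then 1 else 0)) ->
  (forall n w, Y2 n.+1 w = Y2 n w + (1 - X n.+1 w) * u (xi2 n.+1 w) *
                           (if Z n w >= rh2 n w then 1 else 0)) ->
  (* limits of the thresholds *)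
  0 <= rho2 -> rho2 <= rho1 -> rho1 <= 1 ->
  as_cvg P rh1 (fun => rho1) -> as_cvg P rh2 (fun => rho2) ->
  let m1 := ('E_P[fun w => u (xi1 1%N w)])%E in
  let m2 := ('E_P[fun w => u (xi2 1%N w)])%E in
  ((m2 < m1)%E -> as_cvg P Z (fun => rho1)) /\
  (m1 = m2 -> exists Zinf : Om -> R,
      measurable_fun setT Zinf /\
      P [set w | (rho2 <= Zinf w)%R && (Zinf w <= rho1)%R] = 1%E /\
      as_cvg P Z Zinf) /\
  ((m1 < m2)%E -> as_cvg P Z (fun => rho2)).
Proof.
move=> a0 ab mes_u u_ab mxi1 mxi2 mU mphi law1 law2 ixi U_unif _ _ y10_gt0 y20_gt0
  Y10 Y20 Z F UG rh01 Frh1 Frh2 XE Y1E Y2E rho2_ge0 rho21 rho1_le1 crh1 crh2 m1 m2.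
(* Mutual independence is applied to the two indices [(c, i)] and [(c, j)], where [c] selects the
   colour. *)
have pair_indep (c : bool) i j A B : (i < j)%N -> measurable A -> measurable B ->
    P ((if c then xi1 i.+1 else xi2 i.+1) @^-1` A `&`
       (if c then xi1 j.+1 else xi2 j.+1) @^-1` B) =
    (P ((if c then xi1 i.+1 else xi2 i.+1) @^-1` A) *
     P ((if c then xi1 j.+1 else xi2 j.+1) @^-1` B))%E.
  move=> ij mA mB.
  pose E (k : bool * nat) := if k == (c, i)
    then (if c then xi1 i.+1 else xi2 i.+1) @^-1` A
    else (if c then xi1 j.+1 else xi2 j.+1) @^-1` B.
  have ji : ((c, j) == (c, i)) = false by rewrite xpair_eqE eqxx gtn_eqF.
  have uq : uniq [:: (c, i); (c, j)] by rewrite cons_uniq mem_seq1 eq_sym ji.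
  have cl k : k \in [:: (c, i); (c, j)] ->
      pre_class (if k.1 then xi1 k.2.+1 else xi2 k.2.+1) (E k).
    rewrite !inE /E => /orP[] /eqP ->; rewrite ?eqxx ?ji /=.
      by exists A.
    by exists B.
  have := ixi _ E uq cl; rewrite !big_cons big_nil mule1 /E eqxx ji => <-.
  congr (P _); apply/seteqP; split => w /=.
    by move=> [wA wB] k; rewrite /= !inE => /orP[] /eqP ->; rewrite ?eqxx ?ji.
  move=> H; split.
    by have := H (c, i); rewrite eqxx; apply; rewrite /= !inE eqxx.
  by have := H (c, j); rewrite ji; apply; rewrite /= !inE eqxx orbT.
pose r1 := \int[P]_w u (xi1 1%N w); pose r2 := \int[P]_w u (xi2 1%N w).
have dev1 := iid_reward_deviation a0 mes_u u_ab (fun n => mxi1 n.+1) law1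
  (fun i j A B => @pair_indep true i j A B).
have dev2 := iid_reward_deviation a0 mes_u u_ab (fun n => mxi2 n.+1) law2
  (fun i j A B => @pair_indep false i j A B).
have path := ae_urn_path a0 mes_u u_ab mxi1 mxi2 mU mphi U_unif y10_gt0 y20_gt0
  Y10 Y20 UG rh01 Frh1 Frh2 XE Y1E Y2E crh1 crh2 dev1 dev2.
have mZ := share_measurable a0 mes_u u_ab mxi1 mxi2 mU mphi y10_gt0 y20_gt0
  Y10 Y20 rh01 Frh1 Frh2 XE Y1E Y2E.
have Zb n w : 0 <= Z n w <= 1.
  exact: (share_bounds a0 u_ab y10_gt0 y20_gt0 Y10 Y20 XE Y1E Y2E).
have mean (xi : Om -> S) : measurable_fun setT xi ->
    ('E_P[fun w => u (xi w)] = (\int[P]_w u (xi w))%:E)%E.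
  move=> mxi; rewrite unlock /Rintegral fineK//.
  apply: integrable_fin_num => //; apply: bounded_mfun_integrable.
  split; first exact: measurableT_comp.
  exists b => w; have /andP[h1 h2] := u_ab (xi w).
  by rewrite ger0_norm// (le_trans (ltW a0)).
have m1E : m1 = r1%:E by exact: mean.
have m2E : m2 = r2%:E by exact: mean.
rewrite m1E m2E !lte_fin; split; [|split].
- move=> r21; apply: filterS path => w /urn_path_cvg.
  by move=> /(_ a0 (ltW r21) rho2_ge0 rho21 rho1_le1)[l [Zl _ /(_ r21) <-]].
- move=> [r12].
  have Zcvg : {ae P, forall w, exists2 l, rho2 <= l <= rho1 & Z ^~ w @ \oo --> l}.
    apply: filterS path => w /urn_path_cvg.
    by rewrite -/r1 -/r2 r12 => /(_ a0 (lexx _) rho2_ge0 rho21 rho1_le1)[l [Zl ? _]]; exists l.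
  (* The upper limit serves as the limit variable: it is defined on every path, measurable because
     the shares are bounded, and equal to the limit wherever that exists. *)
  have Zlim : {ae P, forall w, rho2 <= limn_sup (Z ^~ w) <= rho1 /\
      Z ^~ w @ \oo --> limn_sup (Z ^~ w)}.
    apply: filterS Zcvg => w [l lrho Zl].
    have -> : limn_sup (Z ^~ w) = l.
      by rewrite cvg_limn_supE; [exact: cvg_lim|apply/cvg_ex; exists l].
    by [].
  have mlim : measurable_fun setT (fun w => limn_sup (Z ^~ w)).
    apply: measurable_fun_limn_sup => // w _.
      by exists 1 => _ [n _ <-]; have /andP[] := Zb n w.
    by exists 0 => _ [n _ <-]; have /andP[] := Zb n w.
  exists (fun w => limn_sup (Z ^~ w)); split=> //; split.
    apply: ae_probability1; last by apply: filterS Zlim => w [].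
    rewrite -[X in measurable X]setTI.
    have mb : measurable_fun setT
        (fun w => (rho2 <= limn_sup (Z ^~ w)) && (limn_sup (Z ^~ w) <= rho1)).
      by apply: measurable_and; apply: measurable_fun_ler.
    exact: mb measurableT [set true] _.
  by apply: filterS Zlim => w [].
- move=> r12; apply: filterS path => w up.
  (* With colours exchanged white has the larger mean, so the white share tends to [1 - rho2]. *)
  have := urn_path_cvg a0 (ltW r12) _ _ _ (urn_path_swap up).
  rewrite subr_ge0 lerD2l lerN2 gerBl.
  move=> /(_ rho1_le1 rho21 rho2_ge0)[l [Yl _ /(_ r12) lE]].
  have ZE n : Z n w = 1 - Y2 n w / (Y1 n w + Y2 n w).
    have := colour_gt0 (urn_red up) n; have := colour_gt0 (urn_white up) n => /= ? ?.
    by rewrite /Z; field; rewrite gt_eqF// addr_gt0.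
  have -> : rho2 = 1 - l by rewrite lE; ring.
  rewrite (_ : (fun n => Z n w) = (fun n => 1 - Y2 n w / (Y1 n w + Y2 n w))).
    by apply: cvgB => //; exact: cvg_cst.
  exact/funext.
Qed.
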